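(* Let $(\Omega,d)$ be the tiling space of a substitution $\omega$ on tilings of $\mathbb R^d$ having finite local complexity, with $\omega$ primitive and injective on $\Omega$, and let $R_s,R_u$ be the stable and unstable equivalence relations on $\Omega$. For all $T,T'\in\Omega$: (1) $T\sim_{R_s}T'$ if and only if there exists $n\in\mathbb N_0=\{0,1,2,\dots\}$ such that $\omega^n(T)(0)=\omega^n(T')(0)$; (2) $T\sim_{R_u}T'$ if and only if there exists $x\in\mathbb R^d$ such that $T'=T+x$.
   Context: Tilings. A tiling $T$ of $\mathbb R^d$ is a CW-structure on $\mathbb R^d$ whose closed $d$-cells (the tiles) are homeomorphic to the closed unit disk; tiles may carry labels. $T$ is also regarded as the collection of its tiles, which cover $\mathbb R^d$ and meet only along their boundaries. A patch is a finite set of tiles of a tiling. For $X\subset\mathbb R^d$, $T(X)$ is the set of tiles of $T$ meeting $X$, and $T(x):=T(\{x\})$; so $T(0)$ is the set of tiles of $T$ containing the origin. $T+x$ is the translate of $T$ by $x$. Two tilings agree on $X$ if $T(X)=T'(X)$. Substitution and tiling space. Fix finitely many prototiles $t_1,\dots,t_N$, an inflation factor $\lambda>1$, and a substitution $\omega$: $\omega(t_i)$ is a patch of translates of prototiles with union $\lambda t_i$, $\omega(t_i+x)=\omega(t_i)+\lambda x$, and $\omega(P)=\bigcup_{t\in P}\omega(t)$ for a patch or tiling $P$. $\Omega$ is the set of all tilings by translates of the prototiles all of whose patches are contained in a translate of $\omega^k(t_j)$ for some $k\in\mathbb N$ and some $j$. The metric is: $d(T,T')$ is the infimum of $\{1/\sqrt2\}\cup\{\varepsilon>0:\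 \exists x,x'\in\mathbb R^d,\ |x|,|x'|<\varepsilon,\ T+x \text{ and } T'+x' \text{ agree on the ball } B_{1/\varepsilon}(0)\}$. Standing assumptions: finite local complexity (for each $r>0$ only finitely many patches of diameter at most $r$ up to translation), $\omega$ primitive (some $\omega^k(t_i)$, $k$ independent of $i$, contains translates of every prototile), and $\omega:\Omega\to\Omega$ injective. Then $\Omega$ is a nonempty compact metric space, contains no periodic tilings, and $\omega:\Omega\to\Omega$ is a homeomorphism. Equivalence relations. $T\sim_{R_s}T'$ means $\lim_{n\to\infty}d(\omega^n(T),\omega^n(T'))=0$; $T\sim_{R_u}T'$ means $\lim_{n\to\infty}d(\omega^{-n}(T),\omega^{-n}(T'))=0$. *)

(* Defs.v *)
From HB Require Import structures.
From mathcomp Require Import all_boot all_order all_algebra.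
From mathcomp Require Import all_classical all_reals all_analysis.
Set Implicit Arguments.
Unset Strict Implicit.
Unset Printing Implicit Defensive.
Import Order.TTheory GRing.Theory Num.Theory.
Import numFieldNormedType.Exports.
Local Open Scope classical_set_scope.
Local Open Scope ring_scope.

(* The library's norm on 'rV[R]_d is the sup norm; balls and distances below
   are Euclidean.  Topological notions (which do not depend on the norm) are
   the library's. *)
Definition enorm (R : realType) (d : nat) (x : 'rV[R]_d) : R :=
  Num.sqrt (\sum_(i < d) x 0 i ^+ 2).

Definition eball (R : realType) (d : nat) (r : R) : set 'rV[R]_d :=
  [set x | enorm x < r].
Definition closed_disk (R : realType) (d : nat) : set 'rV[R]_d :=
  [set x | enorm x <= 1].
Definition open_disk (R : realType) (d : nat) : set 'rV[R]_d :=
  [set x | enorm x < 1].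
Definition sphere (R : realType) (d : nat) : set 'rV[R]_d :=
  [set x | enorm x = 1].

Definition homeomorphism_on (X Y : topologicalType) (A : set X) (B : set Y)
    (f : X -> Y) : Prop :=
  exists g : Y -> X,
    [/\ {within A, continuous f}, {within B, continuous g},
        forall x, A x -> B (f x) /\ g (f x) = x
      & forall y, B y -> A (g y) /\ f (g y) = y].

Definition homeomorphic (X Y : topologicalType) (A : set X) (B : set Y) : Prop :=
  exists f : X -> Y, homeomorphism_on A B f.

(* [C k] is the set of open k-cells; [closure e] is the closed cell of the open
   cell [e].  Cells of R^d automatically have dimension at most d (invariance of
   domain). *)
Record is_cw_structure (R : realType) (d : nat)
    (C : nat -> set (set 'rV[R]_d)) : Prop := {
  cw_dim : forall k e, C k e -> (k <= d)%N;
  cw_cover : forall x, exists k e, C k e /\ e x;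
  cw_disjoint : forall k l e f,
    C k e -> C l f -> e `&` f !=set0 -> k = l /\ e = f;
  cw_char : forall k e, C k e -> exists Phi : 'rV[R]_k -> 'rV[R]_d,
    [/\ {within @closed_disk R k, continuous Phi},
        homeomorphism_on (@open_disk R k) e Phi
      & exists F : set (set 'rV[R]_d),
          [/\ finite_set F,
              forall f, F f -> exists2 l, (l < k)%N & C l f
            & Phi @` @sphere R k `<=` \bigcup_(f in F) f]];
  cw_weak : forall A : set 'rV[R]_d,
    (forall k e, C k e -> closed (A `&` closure e)) -> closed A
}.

Record tile (R : realType) (d : nat) (L : Type) := Tile {
  supp : set 'rV[R]_d;
  label : L
}.

(* A tiling is identified with its set of tiles, so that the CW-structure
   enters existentially.  Its closed d-cells are the supports of the tiles, each
   of which is a subcomplex, and the open d-cell of a tile is its interior;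
   hence distinct tiles meet only along their boundaries. *)
Record is_tiling_with (R : realType) (d : nat) (L : Type)
    (C : nat -> set (set 'rV[R]_d)) (T : set (tile R d L)) : Prop := {
  tiling_cw : is_cw_structure C;
  tiling_cells : C d = [set interior (supp t) | t in T];
  tiling_closed_cells : forall t, T t -> closure (interior (supp t)) = supp t;
  tiling_disk : forall t, T t -> homeomorphic (@closed_disk R d) (supp t);
  tiling_subcomplex : forall t k e, T t -> C k e ->
    e `&` supp t !=set0 -> e `<=` supp t;
  tiling_cover : \bigcup_(t in T) supp t = setT;
  tiling_inj : forall t t', T t -> T t' -> supp t = supp t' -> t = t'
}.

Definition is_tiling (R : realType) (d : nat) (L : Type)
    (T : set (tile R d L)) : Prop :=
  exists C, is_tiling_with C T.

Definition patch_of (R : realType) (d : nat) (L : Type)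
    (T P : set (tile R d L)) : Prop :=
  finite_set P /\ P `<=` T.

Definition is_patch (R : realType) (d : nat) (L : Type)
    (P : set (tile R d L)) : Prop :=
  exists2 T, is_tiling T & patch_of T P.

Definition translate_tile (R : realType) (d : nat) (L : Type)
    (t : tile R d L) (x : 'rV[R]_d) : tile R d L :=
  Tile [set p + x | p in supp t] (label t).

Definition translate (R : realType) (d : nat) (L : Type)
    (T : set (tile R d L)) (x : 'rV[R]_d) : set (tile R d L) :=
  [set translate_tile t x | t in T].

(* T(X) *)
Definition tiles_meeting (R : realType) (d : nat) (L : Type)
    (T : set (tile R d L)) (X : set 'rV[R]_d) : set (tile R d L) :=
  [set t | T t /\ supp t `&` X !=set0].

Definition agree_on (R : realType) (d : nat) (L : Type)
    (T T' : set (tile R d L)) (X : set 'rV[R]_d) : Prop :=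
  tiles_meeting T X = tiles_meeting T' X.

(* omega on patches and tilings, from its values [w t] on single tiles; [w] is
   only ever relevant on translates of prototiles. *)
Definition subst (R : realType) (d : nat) (L : Type)
    (w : tile R d L -> set (tile R d L)) (P : set (tile R d L)) :
    set (tile R d L) :=
  \bigcup_(t in P) w t.

Definition translates_of (R : realType) (d : nat) (L : Type) (N : nat)
    (proto : 'I_N -> tile R d L) : set (tile R d L) :=
  [set t | exists i x, t = translate_tile (proto i) x].

Record is_substitution (R : realType) (d : nat) (L : Type) (N : nat)
    (proto : 'I_N -> tile R d L) (lambda : R)
    (w : tile R d L -> set (tile R d L)) : Prop := {
  proto_disk : forall i, homeomorphic (@closed_disk R d) (supp (proto i));
  inflation_gt1 : 1 < lambda;
  subst_patch : forall i, is_patch (w (proto i));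
  subst_proto : forall i, w (proto i) `<=` translates_of proto;
  subst_supp : forall i, \bigcup_(t in w (proto i)) supp t =
                 [set lambda *: p | p in supp (proto i)];
  subst_translate : forall i x,
    w (translate_tile (proto i) x) = translate (w (proto i)) (lambda *: x)
}.

Definition Omega (R : realType) (d : nat) (L : Type) (N : nat)
    (proto : 'I_N -> tile R d L) (w : tile R d L -> set (tile R d L)) :
    set (set (tile R d L)) :=
  [set T | [/\ is_tiling T, T `<=` translates_of proto
    & forall P, patch_of T P -> exists k j x,
        P `<=` translate (iter k (subst w) [set proto j]) x]].

Definition tiling_dist (R : realType) (d : nat) (L : Type)
    (T T' : set (tile R d L)) : R :=
  inf ([set (Num.sqrt 2)^-1] `|`
       [set eps | 0 < eps /\ exists x x' : 'rV[R]_d,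
          [/\ enorm x < eps, enorm x' < eps
            & agree_on (translate T x) (translate T' x')
                (@eball R d eps^-1)]]).

Definition diam_le (R : realType) (d : nat) (L : Type)
    (P : set (tile R d L)) (r : R) : Prop :=
  forall t t' p q, P t -> P t' -> supp t p -> supp t' q -> enorm (p - q) <= r.

Definition finite_local_complexity (R : realType) (d : nat) (L : Type) (N : nat)
    (proto : 'I_N -> tile R d L) (w : tile R d L -> set (tile R d L)) : Prop :=
  forall r : R, 0 < r -> exists2 F : set (set (tile R d L)), finite_set F &
    forall T P, Omega proto w T -> patch_of T P -> diam_le P r ->
      exists Q x, F Q /\ P = translate Q x.

Definition primitive (R : realType) (d : nat) (L : Type) (N : nat)
    (proto : 'I_N -> tile R d L) (w : tile R d L -> set (tile R d L)) : Prop :=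
  exists k : nat, forall i j : 'I_N, exists x,
    iter k (subst w) [set proto i] (translate_tile (proto j) x).

(* Inverse of omega : Omega -> Omega. *)
Definition subst_inv (R : realType) (d : nat) (L : Type) (N : nat)
    (proto : 'I_N -> tile R d L) (w : tile R d L -> set (tile R d L)) :
    set (tile R d L) -> set (tile R d L) :=
  'pinv_(fun=> set0) (Omega proto w) (subst w).

Definition stable_equiv (R : realType) (d : nat) (L : Type)
    (w : tile R d L -> set (tile R d L)) (T T' : set (tile R d L)) : Prop :=
  tiling_dist (iter n (subst w) T) (iter n (subst w) T') @[n --> \oo] --> (0 : R).

Definition unstable_equiv (R : realType) (d : nat) (L : Type) (N : nat)
    (proto : 'I_N -> tile R d L) (w : tile R d L -> set (tile R d L))
    (T T' : set (tile R d L)) : Prop :=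
  tiling_dist (iter n (subst_inv proto w) T) (iter n (subst_inv proto w) T')
    @[n --> \oo] --> (0 : R).

(* Main.v *)
Require Import Defs.
From mathcomp Require Import all_boot all_order all_algebra.
From mathcomp Require Import all_classical all_reals all_analysis.
From mathcomp Require Import lra.
Set Implicit Arguments.
Unset Strict Implicit.
Unset Printing Implicit Defensive.
Import Order.TTheory GRing.Theory Num.Theory.
Import numFieldNormedType.Exports.
Local Open Scope classical_set_scope.
Local Open Scope ring_scope.


(** Both equivalences compare tilings through local copies: [near_copy T T' y M]
    says that, after a translation by [y], every tile of [T] meeting the ball of
    radius [M] about 0 is a tile of [T'].  Distances tend to 0 exactly when, for
    all [e] and [M], the tilings are eventually local copies with [|y| < e]
    ([cvg_tiling_dist]).  Two facts make such copies rigid.  The substitution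
    turns a copy with data [y, M] into one with data [lambda y, lambda M]
    ([near_copy_subst]); and two translations [y] that are close enough coincide,
    because a tiling by translates of prototiles contains no tile together with
    a very small nonzero translate of it: their interiors would overlap
    ([packing_return], [near_copy_unique]).

    Stable equivalence.  If the distances of the n-th images tend to 0, with
    translations [y_n], then both [lambda y_n] and [y_(n+1)] are small
    translations from [T_(n+1)] to [T'_(n+1)], so they are equal.  The sequence
    is small and grows by the factor [lambda], hence it vanishes, and the
    tilings agree around 0.  Conversely, tilings that agree at 0 agree on a
    ball, which the substitution expands.

    Unstable equivalence.  With the preimages [T_n], [T'_n], uniqueness gives
    [y_n = lambda y_(n+1)] from some [n0] on, so the copies found at later
    stages push forward to copies of [T_n0] in [T'_n0] for the single
    translation [y_n0] on arbitrarily large balls: [T'_n0] is a translate of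
    [T_n0].  Conversely the preimages of [T] and [T + x] differ by the
    translation [lambda^-n x].

    The unstable part requires every tiling in Omega to have a preimage in
    Omega ([desubstitution]).  Primitivity gives, for each [n], a tiling [S_n]
    in Omega whose image agrees with [T] on the ball of radius [n]; the set [S]
    of tiles lying in [S_n] for almost all [n], with respect to a nonprincipal
    ultrafilter, then satisfies [subst w S = T].  It is a cover because only
    finitely many translates of prototiles through a given point have their
    substitution inside [T].  That [S] is again a tiling, namely that it carries a CW-structure,
    does not follow by passing to a limit, as the lower-dimensional cells of
    [S_n] are not determined by its tiles.  Instead the structure is read off
    from that of [lambda^-1 T], which refines [S] ([coarse_tiling]): the cells
    of dimension [d] are the interiors of the tiles of [S], and the others are
    the cells of [lambda^-1 T] lying on the boundaries of these tiles. *)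

(** * Euclidean norm, sup norm and disks *)

Section Norms.
Context (R : realType) (d : nat).
Implicit Types x y : 'rV[R]_d.

Lemma coord_le_norm x i : `|x 0 i| <= `|x|.
Proof.
by rewrite [leRHS]/Num.Def.normr /= mx_normrE; apply/bigmax_geP; right;
  exists (0, i).
Qed.

Lemma norm_le_coords x (M : R) :
  0 <= M -> (forall i, `|x 0 i| <= M) -> `|x| <= M.
Proof.
move=> M0 xM; rewrite [leLHS]/Num.Def.normr /= mx_normrE; apply/bigmax_leP;
  split => //.
by move=> [i j] _ /=; rewrite ord1.
Qed.

Lemma norm_lt_coords x (M : R) :
  0 < M -> (forall i, `|x 0 i| < M) -> `|x| < M.
Proof.
move=> M0 xM; rewrite [ltLHS]/Num.Def.normr /= mx_normrE; apply/bigmax_ltP;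
  split => //.
by move=> [i j] _ /=; rewrite ord1.
Qed.

Lemma norm_le_enorm x : `|x| <= enorm x.
Proof.
apply: norm_le_coords; rewrite ?sqrtr_ge0// => i.
rewrite -sqrtr_sqr ler_wsqrtr// (bigD1 i)//= lerDl.
by apply: sumr_ge0 => j _; rewrite sqr_ge0.
Qed.

Lemma enorm_le_norm x : enorm x <= d%:R * `|x|.
Proof.
rewrite -[leRHS]ger0_norm ?mulr_ge0// -sqrtr_sqr ler_wsqrtr//.
apply: (@le_trans _ _ (\sum_(i < d) `|x| ^+ 2)).
  apply: ler_sum => i _; rewrite -real_normK ?num_real//.
  by rewrite lerXn2r ?nnegrE// coord_le_norm.
rewrite sumr_const card_ord exprMn -[leLHS]mulr_natl ler_wpM2r ?sqr_ge0//.
by rewrite -natrX ler_nat; case: (d) => // n; rewrite expnS expn1 leq_pmulr.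
Qed.

Lemma enormZ (a : R) x : enorm (a *: x) = `|a| * enorm x.
Proof.
rewrite /enorm -sqrtr_sqr -sqrtrM ?sqr_ge0// mulr_sumr; congr Num.sqrt.
by apply: eq_bigr => i _; rewrite mxE exprMn.
Qed.

Lemma enorm_continuous : continuous (@enorm R d).
Proof.
have sumc : continuous (fun x : 'rV[R]_d => \sum_(i < d) x 0 i ^+ 2).
  move=> x; elim: (index_enum _) => [|i s IHs].
    by rewrite (_ : (fun _ => _) = cst 0); [exact: cst_continuous|
      apply/funext => y; rewrite big_nil].
  rewrite (_ : (fun _ => _) = (fun y : 'rV[R]_d => y 0 i ^+ 2)
      \+ (fun y => \sum_(j <- s) y 0 j ^+ 2)); last first.
    by apply/funext => y; rewrite big_cons.
  apply: continuousD => //.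
  apply: (@continuous_comp _ _ _ (fun x : 'rV[R]_d => x 0 i) (fun z => z ^+ 2)).
    exact: coord_continuous.
  exact: exprn_continuous.
move=> x; apply: continuous_comp; [exact: sumc|exact: sqrt_continuous].
Qed.

Lemma enorm_ge0 x : 0 <= enorm x. Proof. exact: sqrtr_ge0. Qed.

Lemma enorm0 : enorm (0 : 'rV[R]_d) = 0.
Proof. by rewrite -(scale0r 0) enormZ normr0 mul0r. Qed.

Lemma compact_closed_disk : compact (@closed_disk R d).
Proof.
apply: bounded_closed_compact.
  exists 1; split; first by rewrite num_real.
  move=> M M1 x /= x1; apply: le_trans (ltW M1).
  exact: le_trans (norm_le_enorm x) x1.
apply: (@preimage_closed _ _ (@enorm R d) [set z | z <= 1]);
  last exact: closed_le.
by move=> x _; exact: enorm_continuous.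
Qed.

Lemma closed_disk_sub : @closed_disk R d `<=` closure (@open_disk R d).
Proof.
move=> x x1 B /nbhs_ballP[e /= e0 eB].
have [a [a0 a1 ae]] : exists a : R, [/\ 0 < a, a < 1 & a * (`|x| + 1) < e].
  have x10 : 0 < `|x| + 1 by rewrite ltr_wpDl.
  exists (Num.min 2^-1 (e / 2 / (`|x| + 1))); split.
  - by rewrite lt_min invr_gt0 ltr0n /= !divr_gt0.
  - by rewrite gt_min; apply/orP; left; rewrite invf_lt1 ?ltr0n// ltr1n.
  rewrite -ltr_pdivlMr// gt_min; apply/orP; right.
  by rewrite ltr_pM2r ?invr_gt0//; lra.
exists ((1 - a) *: x); split.
  rewrite /open_disk /= enormZ ger0_norm; last by lra.
  have := enorm_ge0 x; move: x1; rewrite /closed_disk /=; nra.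
apply: eB; rewrite -ball_normE /ball_ /=.
rewrite scalerBl scale1r opprB addrC subrK normrZ gtr0_norm//.
apply: le_lt_trans ae; rewrite ler_pM2l//; lra.
Qed.

End Norms.

(** * Transport of tilings along homeomorphisms of the space *)

Definition map_tile (R : realType) (d : nat) (L : Type)
    (f : 'rV[R]_d -> 'rV[R]_d) (t : tile R d L) : tile R d L :=
  Tile (f @` supp t) (label t).

Section Transport.
Context (R : realType) (d : nat) (L : Type) (f g : 'rV[R]_d -> 'rV[R]_d).
Context (fc : continuous f) (gc : continuous g).
Context (fK : cancel f g) (gK : cancel g f).

Lemma image_homeo (A : set 'rV[R]_d) : f @` A = g @^-1` A.
Proof.
apply/seteqP; split=> [_ [x Ax <-]|x Ax] /=; first by rewrite fK.
by exists (g x).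
Qed.

Lemma closure_homeo (A : set 'rV[R]_d) : closure (f @` A) = f @` closure A.
Proof.
rewrite !image_homeo; apply/seteqP; split=> x Ax B Bx.
  have /Ax[y [Ay By]] : nbhs x (g @^-1` B) by exact: gc.
  by exists (g y).
have /Ax[y [Ay By]] : nbhs (g x) (f @^-1` B) by apply: fc; rewrite gK.
by exists (f y); split=> //=; rewrite fK.
Qed.

Lemma interior_homeo (A : set 'rV[R]_d) : (f @` A)^° = f @` A^°.
Proof.
rewrite !image_homeo; apply/seteqP; split=> x Ax.
  have : nbhs (g x) (f @^-1` (g @^-1` A)) by apply: fc; rewrite gK.
  by apply: filterS => y Ay; rewrite -[y]fK.
by have : nbhs x (g @^-1` A) by exact: gc.
Qed.

Lemma homeomorphism_on_homeo (k : nat) (D : set 'rV[R]_k) (A : set 'rV[R]_d) h :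
  homeomorphism_on D A h -> homeomorphism_on D (f @` A) (f \o h).
Proof.
move=> [h' [hc h'c hA h'A]]; exists (h' \o g); split.
- by apply: within_continuous_comp => // x _; exact: fc.
- apply/subspace_continuousP => x [y Ay <-].
  move/subspace_continuousP : h'c => /(_ y Ay) h'c.
  move=> B hB; have {}hB : nbhs (h' y) B by rewrite -[y]fK.
  have {h'c} h'B := h'c _ hB.
 have : nbhs (f y) (g @^-1` [set z | A z -> B (h' z)]).
    by apply: gc; rewrite fK.
  apply: filterS => z /= zB [z' Az' zz']; apply: zB.
  by rewrite -zz' fK.
- move=> x /hA[Ahx xK] /=; rewrite fK; split => //.
  by exists (h x).
- by move=> _ [y /h'A[Dy yK] <-] /=; rewrite fK yK.
Qed.

Lemma cw_homeo (C : nat -> set (set 'rV[R]_d)) :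
  is_cw_structure C -> is_cw_structure (fun k => [set f @` e | e in C k]).
Proof.
move=> [dimC covC disjC charC weakC]; split.
- by move=> k _ [e Ce _]; exact: dimC Ce.
- move=> x; have [k [e [Ce ex]]] := covC (g x).
  by exists k, (f @` e); split; [exists e|exists (g x)].
- move=> k l _ _ [e Ce <-] [e' Ce' <-] [_ [[x ex <-] [y e'y yx]]].
  have yx' : y = x by rewrite -[y]fK yx fK.
  have [|-> ->//] := disjC _ _ _ _ Ce Ce'.
  by exists x; split => //; rewrite -yx'.
- move=> k _ [e Ce <-]; have [Phi [Phic Phih [F [finF Flow FPhi]]]] :=
  charC _ _ Ce.
  exists (f \o Phi); split.
  + by apply: within_continuous_comp => // x _; exact: fc.
  + exact: homeomorphism_on_homeo.
  + exists [set f @` e | e in F]; split; first exact: finite_image.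
      by move=> _ [e' /Flow[l lk Cle'] <-]; exists l => //; exists e'.
    move=> _ [x xs <-]; have [|e' Fe' xe'] := FPhi (Phi x); first by exists x.
    by exists (f @` e'); [exists e'|exists (Phi x)].
- move=> A Aclosed.
  suff : closed (f @^-1` A).
    move=> fA; have -> : A = g @^-1` (f @^-1` A).
      by apply/seteqP; split=> x /=; rewrite gK.
    by apply: preimage_closed => // x _; exact: gc.
  apply: weakC => k e Ce.
  have -> : f @^-1` A `&` closure e = f @^-1` (A `&` closure (f @` e)).
    apply/seteqP; split=> x [Ax ex]; split => //; rewrite closure_homeo in ex *.
      by exists x.
    by have [y ey /(can_inj fK) <-] := ex.
  apply: preimage_closed; first by move=> x _; exact: fc.
  by apply: (Aclosed k); exists e.
Qed.

Lemma tiling_homeo (T : set (tile R d L)) :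
  is_tiling T -> is_tiling [set map_tile f t | t in T].
Proof.
move=> [C [cwC cellC closC diskC subC covC injC]].
exists (fun k => [set f @` e | e in C k]); split.
- exact: cw_homeo.
- rewrite cellC; apply/seteqP;
  split=> [_ [_ [t Tt <-] <-]|_ [_ [t Tt <-] <-]] /=.
    by exists (map_tile f t) => /=; [exists t|rewrite interior_homeo].
  by exists (supp t)^°; [exists t|rewrite interior_homeo].
- by move=> _ [t Tt <-] /=; rewrite interior_homeo closure_homeo closC.
- move=> _ [t /diskC[h hh] <-] /=; exists (f \o h).
  exact: homeomorphism_on_homeo.
- move=> _ k _ [t Tt <-] [e Ce <-] [_ [[x ex <-] [y ty yx]]] /=.
  have yx' : y = x by rewrite -[y]fK yx fK.
  apply: image_subset; apply: (subC _ _ _ Tt Ce).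
  by exists x; split => //; rewrite -yx'.
- apply/seteqP; split => // x _.
  have [t Tt tx] : (\bigcup_(t in T) supp t) (g x) by rewrite covC.
  by exists (map_tile f t); [exists t|exists (g x)].
- move=> _ _ [t Tt <-] [t' Tt' <-] /= tt'.
  congr map_tile; apply: injC => //; rewrite !image_homeo in tt'.
  have fgK A : A = f @^-1` (g @^-1` A).
    by apply/seteqP; split=> x; rewrite /preimage /= fK.
  by rewrite (fgK (supp t)) tt' -fgK.
Qed.

End Transport.

(** * Tiles of a tiling *)

Section TilingFacts.
Context (R : realType) (d : nat) (L : Type).
Implicit Types (T : set (tile R d L)) (t : tile R d L) (x : 'rV[R]_d).

Definition locally_finite T : Prop :=
  forall x, exists2 U, nbhs x U & finite_set (tiles_meeting T U).

Lemma closed_finite_union T :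
  finite_set T -> (forall t, T t -> closed (supp t)) ->
  closed (\bigcup_(t in T) supp t).
Proof.
move=> finT clT.
have -> : \bigcup_(t in T) supp t = \bigcup_(A in [set supp t | t in T]) A.
  by rewrite bigcup_image.
apply: closed_bigcup; first exact: finite_image.
by move=> _ [t /clT ? <-].
Qed.

(** Among the finitely many tiles met by a small neighborhood of [x], those that
    miss [x] form a closed set, which can be removed. *)
Lemma star_nbhs T x :
  locally_finite T -> (forall t, T t -> closed (supp t)) ->
  exists2 V, nbhs x V & forall t, T t -> supp t `&` V !=set0 -> supp t x.
Proof.
move=> /(_ x)[U Ux finU] clT.
pose Z := \bigcup_(t in tiles_meeting T U `&` [set t | ~ supp t x]) supp t.
have Zcl : closed Z.
  apply: closed_finite_union; first exact: finite_setIl.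
  by move=> t [[/clT]].
have Zx : ~ Z x by move=> [t [_]].
exists (U `&` ~` Z).
  by apply: filterI => //; apply: open_nbhs_nbhs; split => //;
    exact: closed_openC.
move=> t Tt [y [ty [Uy nZy]]]; apply: contrapT => ntx; apply: nZy.
by exists t => //; split => //; split => //; exists y.
Qed.

Lemma tiling_closed T t : is_tiling T -> T t -> closed (supp t).
Proof.
by move=> [C hC] Tt; rewrite -(tiling_closed_cells hC Tt);
  exact: closed_closure.
Qed.

Lemma closure_int T t : is_tiling T -> T t -> closure (supp t)^° = supp t.
Proof. by move=> [C hC]; exact: tiling_closed_cells hC _. Qed.

(** Interiors of tiles are [d]-cells, so overlapping ones are the same cell, and
    a tile is recovered from its interior by taking the closure. *)
Lemma disjoint_interiors T t t' : is_tiling T -> T t -> T t' ->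
  (supp t)^° `&` (supp t')^° !=set0 -> t = t'.
Proof.
move=> [C hC] Tt Tt' tt'.
have Cd s : T s -> C d (supp s)^° by rewrite (tiling_cells hC) => ?; exists s.
have [_ ss'] := cw_disjoint (tiling_cw hC) (Cd _ Tt) (Cd _ Tt') tt'.
apply: (tiling_inj hC) => //.
by rewrite -(tiling_closed_cells hC Tt) ss' (tiling_closed_cells hC Tt').
Qed.

Lemma open_meets_interior T t (U : set 'rV[R]_d) : is_tiling T -> T t ->
  open U -> supp t `&` U !=set0 -> (supp t)^° `&` U !=set0.
Proof.
move=> hT Tt Uo [x [tx Ux]]; rewrite -(closure_int hT Tt) in tx.
by apply: tx; exact: open_nbhs_nbhs.
Qed.

Lemma interior_meets T t t' : is_tiling T -> T t -> T t' ->
  (supp t)^° `&` supp t' !=set0 -> t = t'.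
Proof.
move=> hT Tt Tt'; rewrite setIC => tt'; apply: (disjoint_interiors hT) => //.
by rewrite setIC; exact: (open_meets_interior hT Tt' (@open_interior _ _)).
Qed.

Lemma tiling_tile T x : is_tiling T -> exists2 t, T t & supp t x.
Proof.
move=> [C hC]; suff [t ? ?] : (\bigcup_(t in T) supp t) x by exists t.
by rewrite (tiling_cover hC).
Qed.

(** Inclusion on one side is enough for agreement on an open set: a tile of [T']
    meeting [U] has interior points in [U], and these are already covered by
    tiles of [T], which belong to [T']. *)
Lemma agree_of_sub T T' (U : set 'rV[R]_d) : is_tiling T -> is_tiling T' ->
  open U -> tiles_meeting T U `<=` T' -> tiles_meeting T' U = tiles_meeting T U.
Proof.
move=> hT hT' Uo sub; apply/seteqP; split=> [t [T't tU]|t tU]; last first.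
  by split; [exact: sub|case: tU].
have [x [tx Ux]] := open_meets_interior hT' T't Uo tU.
have [s Ts sx] := tiling_tile x hT.
have sU : tiles_meeting T U s by split => //; exists x.
suff -> : t = s by [].
by apply: (interior_meets hT') => //; [exact: sub|exists x].
Qed.

Lemma supp_compact t : homeomorphic (@closed_disk R d) (supp t) ->
  compact (supp t).
Proof.
move=> [h [h' [hc _ hin h'in]]].
have -> : supp t = h @` closed_disk (d:=d).
  apply/seteqP; split=> [y /h'in[? ?]|_ [x /hin[? _] <-]] //.
  by exists (h' y).
by apply: continuous_compact => //; exact: compact_closed_disk.
Qed.

Lemma supp_nonempty t : homeomorphic (@closed_disk R d) (supp t) ->
  supp t !=set0.
Proof.
move=> [h [? [_ _ hin _]]]; exists (h 0).
have /hin[] : closed_disk (0 : 'rV[R]_d) by rewrite /closed_disk /= enorm0.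
by [].
Qed.

Lemma tiling_homeomorphic T t : is_tiling T -> T t ->
  homeomorphic (@closed_disk R d) (supp t).
Proof. by move=> [C hC]; exact: tiling_disk hC _. Qed.

Lemma interior_nonempty T t : is_tiling T -> T t -> (supp t)^° !=set0.
Proof.
move=> hT Tt; have [x tx] := supp_nonempty (tiling_homeomorphic hT Tt).
by rewrite -[X in X !=set0]setIT; apply: (open_meets_interior hT Tt);
  [exact: openT|exists x].
Qed.

End TilingFacts.

(** * Tilings refined by a CW tiling *)

Section Cells.
Context (R : realType) (d : nat).

Lemma open_sub_closed_disk k : @open_disk R k `<=` @closed_disk R k.
Proof. by move=> x /ltW. Qed.

(** Boundary points of the disk are limits of interior points, so a
    characteristic map sends the closed disk into the closed cell. *)
Lemma image_disk_sub_closure k (e : set 'rV[R]_d) (Phi : 'rV[R]_k -> 'rV[R]_d) :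
  {within @closed_disk R k, continuous Phi} ->
  (forall x, open_disk x -> e (Phi x)) ->
    Phi @` @closed_disk R k `<=` closure e.
Proof.
move=> /subspace_continuousP Phic Phie _ [x x1 <-] B BPhi.
have nB : nbhs x [set z | closed_disk z -> B (Phi z)] := Phic x x1 _ BPhi.
have [z [z1 zB]] := closed_disk_sub x1 nB.
by exists (Phi z); split; [exact: Phie|exact/zB/open_sub_closed_disk].
Qed.

Lemma closure_sub_image_disk k (e : set 'rV[R]_d) (Phi : 'rV[R]_k -> 'rV[R]_d) :
  {within @closed_disk R k, continuous Phi} ->
  e `<=` Phi @` @open_disk R k -> closure e `<=` Phi @` @closed_disk R k.
Proof.
move=> Phic ePhi.
have cl : closed (Phi @` @closed_disk R k).
  apply: compact_closed; first exact: norm_hausdorff.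
  by apply: continuous_compact => //; exact: compact_closed_disk.
rewrite closureE; apply: smallest_sub => //.
by apply: subset_trans ePhi _; apply: image_subset; exact: open_sub_closed_disk.
Qed.

Lemma homeomorphism_on_image k (e : set 'rV[R]_d) (D : set 'rV[R]_k)
    (Phi : 'rV[R]_k -> 'rV[R]_d) :
  homeomorphism_on D e Phi -> Phi @` D = e.
Proof.
move=> [Psi [_ _ De eD]]; apply/seteqP;
  split=> [_ [x /De[? _] <-]//|y /eD[? ?]].
by exists (Psi y).
Qed.

Lemma sphere_or_open k (x : 'rV[R]_k) : closed_disk x ->
  open_disk x \/ sphere x.
Proof.
rewrite /closed_disk /open_disk /sphere /= le_eqVlt => /orP[/eqP|]; tauto.
Qed.

(** Closure-finiteness: by compactness of the disk, the closed cell is the image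
    of its characteristic map, hence the open cell plus the cells covering the
    image of the sphere. *)
Lemma closed_cell_finite (C : nat -> set (set 'rV[R]_d)) k e :
  is_cw_structure C -> C k e -> exists F, [/\ finite_set F,
    forall f, F f -> exists l, C l f & closure e `<=` \bigcup_(f in F) f].
Proof.
move=> cwC Ce; have [Phi [Phic Phih [F [finF FC FPhi]]]] := cw_char cwC Ce.
exists (e |` F); split.
- by rewrite finite_setU; split => //; exact: finite_set1.
- by move=> f [->|/FC[l _ Cf]]; [exists k|exists l].
have PhiE := homeomorphism_on_image Phih.
move=> y /(closure_sub_image_disk Phic)[|x x1 <-]; first by rewrite PhiE.
case: (sphere_or_open x1) => [x1'|xs].
  by exists e; [left|rewrite -PhiE; exists x].
by have [|f Ff fx] := FPhi (Phi x); [exists x|exists f => //; right].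
Qed.

(** This yields the weak topology axiom from the closed [d]-cells alone. *)
Lemma closed_of_locally_finite L (T : set (tile R d L)) (A : set 'rV[R]_d) :
  locally_finite T -> (forall t, T t -> closed (A `&` supp t)) ->
  \bigcup_(t in T) supp t = setT -> closed A.
Proof.
move=> lfT clA covT x Ax; have [U Ux finU] := lfT x.
pose S := [set Tile (A `&` supp t) (label t) | t in tiles_meeting T U].
have : closed (\bigcup_(s in S) supp s).
  apply: closed_finite_union; first exact: finite_image.
  by move=> _ [t [Tt _] <-] /=; exact: clA.
move=> /(_ x)[|_ [t _ <-] []//].
move=> V Vx; have [y [Ay [Uy Vy]]] := Ax _ (filterI Ux Vx).
exists y; split => //.
have : setT y by []. rewrite -covT => -[t Tt ty].
exists (Tile (A `&` supp t) (label t)) => //.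
by exists t => //; split => //; exists y.
Qed.

End Cells.

(** [S] is a family of tiles, each of which is a finite union of tiles of a CW
    tiling [T].  It inherits from [T] a CW-structure as soon as it covers the
    space, is locally finite, and any two of its tiles occur together in some
    tiling. *)
Section Coarsen.
Context (R : realType) (d : nat) (L : Type).
Context (T S : set (tile R d L)).
Context (hT : is_tiling T).
Context (lfT : locally_finite T).
Context (lfS : locally_finite S).
Context (S_cover : \bigcup_(s in S) supp s = setT).
Context (S_pairs : forall s s', S s -> S s' ->
  exists T', [/\ is_tiling T', T' s & T' s']).
Context (S_union : forall s, S s ->
  exists2 P, patch_of T P & \bigcup_(t in P) supp t = supp s).

Let S_meets s s' : S s -> S s' -> (supp s)^° `&` supp s' !=set0 -> s = s'.
Proof. by move=> /S_pairs/[apply] -[T' [hT' ? ?]];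
  exact: interior_meets hT' _ _. Qed.

Let S_closed s : S s -> closed (supp s).
Proof. by move=> Ss; have [T' [hT' Ts _]] := S_pairs Ss Ss;
  exact: tiling_closed Ts. Qed.

Section With_cells.
Context (C : nat -> set (set 'rV[R]_d)).
Context (hC : is_tiling_with C T).
Let cwC := tiling_cw hC.

Let bd (s : tile R d L) := supp s `\` (supp s)^°.

Let closed_bd s : S s -> closed (bd s).
Proof.
by move=> Ss; rewrite /bd setDE; apply: closedI; [exact: S_closed|
  exact/open_closedC/open_interior].
Qed.

Let cell_sub k e s : C k e -> S s -> e `&` supp s !=set0 -> e `<=` supp s.
Proof.
move=> Ce Ss [x [ex sx]]; have [P [_ PT] PE] := S_union Ss.
rewrite -PE in sx *; case: sx => t Pt tx y ey; exists t => //.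
by apply: (tiling_subcomplex hC (PT _ Pt) Ce) ey; exists x.
Qed.

(** A cell meeting the interior of [s] lies in it: every tile of [T] close to a
    point [y] of the cell contains [y], hence the whole cell, hence meets the
    interior of [s], and so is one of the tiles of which [s] is the union. *)
Let cell_sub_interior k e s : C k e -> S s -> e `&` (supp s)^° !=set0 ->
  e `<=` (supp s)^°.
Proof.
move=> Ce Ss [x [ex sx]] y ey; have [P [_ PT] PE] := S_union Ss.
have [V Vy VT] := star_nbhs y lfT (fun t => @tiling_closed _ _ _ _ _ hT).
apply: filterS Vy => z Vz; have [t Tt tz] := tiling_tile z hT.
have ty : supp t y by apply: VT => //; exists z.
have tx : supp t x by apply: (tiling_subcomplex hC Tt Ce) ex; exists y.
have [|q [tq /interior_subset]] :=
  open_meets_interior hT Tt (@open_interior _ (supp s)).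
  by exists x.
rewrite -PE => -[t' Pt' t'q].
have tt' : t = t' by apply: (interior_meets hT) => //; [exact: PT|exists q].
by exists t' => //; rewrite -tt'.
Qed.

Let cell_sub_bd k e s : C k e -> S s -> e `&` bd s !=set0 -> e `<=` bd s.
Proof.
move=> Ce Ss [x [ex [sx nsx]]] y ey; split.
  by apply: (cell_sub Ce Ss) ey; exists x.
move=> sy; apply: nsx; apply: (cell_sub_interior Ce Ss) ex; by exists y.
Qed.

(** A [d]-cell is open, so it cannot lie in a boundary. *)
Let bd_dim k e s : C k e -> S s -> e `&` bd s !=set0 -> (k < d)%N.
Proof.
move=> Ce Ss esN; have eb := cell_sub_bd Ce Ss esN.
rewrite ltn_neqAle (cw_dim cwC Ce) andbT; apply/eqP => kd.
have eo : open e.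
  move: Ce; rewrite kd (tiling_cells hC) => -[t _ <-]; exact: open_interior.
have [x [ex [sx]]] := esN; apply.
by apply: filterS (open_nbhs_nbhs (conj eo ex)) => y /eb[].
Qed.

(** The boundary of [s] is covered by the cells in the closed [d]-cells of [T]
    that make up [s]. *)
Let bd_finite s : S s -> exists F : set (set 'rV[R]_d), [/\ finite_set F,
  forall f, F f -> exists2 l, (l < d)%N & C l f /\ f `<=` bd s
  & bd s `<=` \bigcup_(f in F) f].
Proof.
move=> Ss; have [P [finP PT] PE] := S_union Ss.
have fc t : exists F : set (set 'rV[R]_d), P t -> [/\ finite_set F,
    forall f, F f -> exists l, C l f & supp t `<=` \bigcup_(f in F) f].
  have [Pt|nPt] := pselect (P t); last by exists set0.
  have Ct : C d (supp t)^° by rewrite (tiling_cells hC); exists t => //;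
    exact: PT.
  have [F] := closed_cell_finite cwC Ct.
  by rewrite (tiling_closed_cells hC (PT _ Pt)) => ?; exists F.
have {fc}[F PF] := choice fc.
exists ((\bigcup_(t in P) F t) `&` [set f | f `&` bd s !=set0]); split.
- by apply: finite_setIl; apply: bigcup_finite => // t /PF[].
- move=> f [[t Pt Ff] fs]; have [_ /(_ _ Ff)[l Cf] _] := PF t Pt.
  by exists l; [exact: bd_dim fs|split => //; exact: cell_sub_bd Cf Ss fs].
- move=> x sx; have := sx.1; rewrite -PE => -[t Pt tx].
  have [_ _ /(_ x tx)[f Ff fx]] := PF t Pt.
  by exists f => //; split; [exists t|exists x].
Qed.

Definition coarse_cells k : set (set 'rV[R]_d) := if k == d then
    [set (supp s)^° | s in S]
  else [set e | C k e /\ exists2 s, S s & e `<=` bd s].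

Lemma coarse_cellsP k e : coarse_cells k e <->
  (k = d /\ exists2 s, S s & (supp s)^° = e) \/
  [/\ (k < d)%N, C k e & exists2 s, S s & e `<=` bd s].
Proof.
rewrite /coarse_cells; case: eqP => [->|kd] /=; split.
- by left.
- by case=> [[]//|[]]; rewrite ltnn.
- case=> Ce es; right; split => //.
  by rewrite ltn_neqAle (cw_dim cwC Ce) andbT; exact/eqP.
- by case=> [[]//|[]].
Qed.

(** The characteristic map of a [d]-cell, the interior of a tile [s] of [S], is
    borrowed from another tiling containing [s]; a homeomorphism from the closed
    disk to [supp s] would not do, since that it maps the open disk onto the
    interior is invariance of domain.  In the borrowed structure the sphere goes
    to lower cells, which miss the interior of [s], hence to the boundary of
    [s]. *)
Lemma coarse_cw : is_cw_structure coarse_cells.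
Proof.
have mixed k e s s' : S s -> C k e -> S s' -> e `<=` bd s' ->
    e `&` (supp s)^° !=set0 -> False.
  move=> Ss Ce Ss' es' [x [ex sx]]; have [s'x ns'x] := es' _ ex.
  apply: ns'x; rewrite -(_ : s = s')//; apply: S_meets => //; by exists x.
split.
- by move=> k e /coarse_cellsP[[->//]|[/ltnW]].
- move=> x; have [s Ss sx] : (\bigcup_(s in S) supp s) x by rewrite S_cover.
  have [six|nsx] := pselect ((supp s)^° x).
    by exists d, (supp s)^°; split => //; apply/coarse_cellsP; left;
      split => //; exists s.
  have [k [e [Ce ex]]] := cw_cover cwC x.
  have es : e `&` bd s !=set0 by exists x.
  exists k, e; split => //; apply/coarse_cellsP; right; split => //.
    exact: bd_dim es.
  by exists s => //; exact: cell_sub_bd Ce Ss es.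
- move=> k l e f /coarse_cellsP[[-> [s Ss <-]]|[kd Ce [s Ss es]]]
    /coarse_cellsP[[-> [s' Ss' <-]]|[ld Cf [s' Ss' fs']]] ef.
  + split => //; rewrite (_ : s = s')//; apply: S_meets => //.
    by case: ef => x [sx s'x]; exists x; split => //; exact: interior_subset.
  + by exfalso; apply: (mixed _ _ _ _ Ss Cf Ss' fs'); rewrite setIC.
  + by exfalso; exact: (mixed _ _ _ _ Ss' Ce Ss es).
  + exact: cw_disjoint cwC _ _ _ _ Ce Cf ef.
- move=> k e /coarse_cellsP[[-> [s Ss <-]]|[kd Ce [s Ss es]]].
    have [T' [hT' T's _]] := S_pairs Ss Ss; have [C' hC'] := hT'.
    have C's : C' d (supp s)^° by rewrite (tiling_cells hC'); exists s.
    have [Phi [Phic Phih [F' [_ F'C' F'Phi]]]] := cw_char (tiling_cw hC') C's.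
    exists Phi; split => //.
    have [F [finF FC sF]] := bd_finite Ss; exists F; split => //.
      move=> f Ff; have [l ld [Cf fs]] := FC _ Ff; exists l => //.
      by apply/coarse_cellsP; right; split => //; exists s.
    move=> y Phiy; apply: sF; split.
      rewrite -(closure_int hT' T's).
      apply: (image_disk_sub_closure Phic).
        by move=> x x1; rewrite -(homeomorphism_on_image Phih); exists x.
      by case: Phiy => x x1 <-; exists x => //; rewrite /closed_disk /= x1.
    move=> sy; have [f F'f fy] := F'Phi _ Phiy.
    have [l ld C'f] := F'C' _ F'f.
    have [|dl _] := cw_disjoint (tiling_cw hC') C's C'f; first by exists y.
    by rewrite -dl ltnn in ld.
  have [Phi [Phic Phih [F [finF FC FPhi]]]] := cw_char cwC Ce.
  exists Phi; split => //.
  have Phi_bd : Phi @` @sphere R k `<=` bd s.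
    apply: (@subset_trans _ (closure e)).
      move=> _ [x x1 <-]; apply: (image_disk_sub_closure Phic).
        by move=> z z1; rewrite -(homeomorphism_on_image Phih); exists z.
      by exists x => //; rewrite /closed_disk /= x1.
    by rewrite closureE; apply: smallest_sub => //; exact: closed_bd.
  exists (F `&` [set f | f `&` bd s !=set0]); split; first exact: finite_setIl.
    move=> f [/FC[l lk Cf] fs]; exists l => //; apply/coarse_cellsP; right.
    split => //; first exact: bd_dim fs.
    by exists s => //; exact: cell_sub_bd Cf Ss fs.
  move=> y Phiy; have [f Ff fy] := FPhi _ Phiy.
  by exists f => //; split => //; exists y; split => //; exact: Phi_bd.
- move=> A clA; apply: (closed_of_locally_finite lfS) => // s Ss.
  have [T' [hT' T's _]] := S_pairs Ss Ss; rewrite -(closure_int hT' T's).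
  by apply: (clA d); apply/coarse_cellsP; left; split => //; exists s.
Qed.

Lemma coarse_tiling_with : is_tiling_with coarse_cells S.
Proof.
split.
- exact: coarse_cw.
- by rewrite /coarse_cells eqxx.
- by move=> s Ss; have [T' [hT' T's _]] := S_pairs Ss Ss;
  exact: closure_int T's.
- move=> s Ss; have [T' [hT' T's _]] := S_pairs Ss Ss.
  exact: tiling_homeomorphic T's.
- move=> s k e Ss /coarse_cellsP[[_ [s' Ss' <-]]|[_ Ce _]].
    by move=> /(S_meets Ss' Ss) <-; exact: interior_subset.
  exact: cell_sub Ce Ss.
- exact: S_cover.
- move=> s s' Ss Ss' ss'; have [T' [hT' T's T's']] := S_pairs Ss Ss'.
  by have [C' hC'] := hT'; exact: tiling_inj hC' _ _ T's T's' ss'.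
Qed.

End With_cells.

Lemma coarse_tiling : is_tiling S.
Proof. by have [C hC] := hT; exists (coarse_cells C);
  exact: coarse_tiling_with. Qed.

End Coarsen.

(** * Growth of powers and multiples *)

Section Growth.
Context (R : realType).

Lemma power_unbounded (l M : R) : 1 < l -> exists n : nat, M < l ^+ n.
Proof.
move=> l1; have l10 : 0 < l - 1 by rewrite subr_gt0.
have bernoulli n : n%:R * (l - 1) < l ^+ n.
  elim: n => [|n IHn]; first by rewrite mul0r expr0.
  have : 1 <= l ^+ n by rewrite exprn_ege1// ltW.
  rewrite exprS -natr1; nra.
exists (Num.truncn (M / (l - 1))).+1; apply: le_lt_trans (bernoulli _).
by rewrite -ler_pdivrMr// ltW// truncnS_gt.
Qed.

Lemma bounded_multiples_eq0 (x D : R) :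
  0 <= x -> (forall n, x *+ n <= D) -> x = 0.
Proof.
move=> x0 xD; apply/eqP; apply: contrapT => /negP xn0.
have {xn0}x0 : 0 < x by rewrite lt_neqAle eq_sym xn0.
have := xD (Num.truncn (D / x)).+1; rewrite leNgt => /negP; apply.
by rewrite -mulr_natl -ltr_pdivrMr// truncnS_gt.
Qed.

End Growth.

(** * Translates of tiles *)

Section Translation.
Context (R : realType) (d : nat) (L : Type).
Implicit Types (T : set (tile R d L)) (t : tile R d L) (x y p : 'rV[R]_d).

Lemma supp_translate t x p : supp (translate_tile t x) p <-> supp t (p - x).
Proof.
split=> [[q tq <-]|tp]; first by rewrite addrK.
by exists (p - x); rewrite ?subrK.
Qed.

Lemma translate_tile0 t : translate_tile t 0 = t.
Proof.
case: t => A l; rewrite /translate_tile /=; congr Tile.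
by apply/seteqP; split=> [_ [p Ap <-]|p Ap]; [rewrite addr0|exists p;
  rewrite ?addr0].
Qed.

Lemma translate_tileD t x y :
  translate_tile (translate_tile t x) y = translate_tile t (x + y).
Proof.
case: t => A l; rewrite /translate_tile /=; congr Tile.
apply/seteqP; split=> [_ [_ [p Ap <-] <-]|_ [p Ap <-]].
  by exists p => //; rewrite addrA.
by exists (p + x); [exists p|rewrite addrA].
Qed.

Lemma translateP T x t : translate T x t <-> T (translate_tile t (- x)).
Proof.
split=> [[s Ts <-]|Tt]; first by rewrite translate_tileD subrr translate_tile0.
by exists (translate_tile t (- x)) => //;
  rewrite translate_tileD addNr translate_tile0.
Qed.

Lemma translateD T x y : translate (translate T x) y = translate T (x + y).
Proof.
by apply/seteqP; split=> t;
  rewrite !translateP translate_tileD opprD [- y - x]addrC.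
Qed.

Lemma translate0 T : translate T 0 = T.
Proof. by apply/seteqP; split=> t; rewrite translateP oppr0 translate_tile0.
  Qed.

Lemma addr_continuous x : continuous (fun p => p + x).
Proof.
by move=> p; apply: (@continuousD _ _ _ id (cst x));
  [exact: cvg_id|exact: cst_continuous].
Qed.

Lemma tiling_translate T x : is_tiling T -> is_tiling (translate T x).
Proof.
exact: (tiling_homeo (addr_continuous (x:=x)) (addr_continuous (x:=- x))
  (addrK x) (subrK x)).
Qed.

Lemma interior_translate t x p :
  (supp (translate_tile t x))^° p <-> (supp t)^° (p - x).
Proof.
rewrite /translate_tile /= (interior_homeo (addr_continuous (x:=x))
  (addr_continuous (x:=- x)) (addrK x) (subrK x)).
by rewrite (image_homeo (addrK x) (subrK x)).
Qed.

Lemma translate_patch T P x : patch_of T P ->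
  patch_of (translate T x) (translate P x).
Proof. by move=> [finP PT]; split; [exact: finite_image|exact: image_subset].
  Qed.

End Translation.

(** * Packings by tiles of bounded shape *)

Section Packing.
Context (R : realType) (d : nat) (L : Type).
Implicit Types (T : set (tile R d L)) (t : tile R d L).

Definition packing T : Prop := forall t t', T t -> T t' ->
  (supp t)^° `&` (supp t')^° !=set0 -> t = t'.

Definition sup_ball (r : R) : set 'rV[R]_d := [set p | `|p| < r].

(** Uniform bounds for the tiles in [A]: diameters at most [D], and an inscribed
    sup-norm ball of radius [r] about the chosen center [c t]. *)
Record shape_bounds (A : set (tile R d L)) (D r : R)
    (c : tile R d L -> 'rV[R]_d) : Prop := {
  shape_diam : forall t p q, A t -> supp t p -> supp t q -> `|p - q| <= D;
  shape_inner : 0 < r;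
  shape_center : forall t p, A t -> `|c t - p| < r -> (supp t)^° p
}.

Lemma open_sup_ball r : open (sup_ball r).
Proof.
have -> : sup_ball r = (fun p : 'rV[R]_d => `|p|) @^-1` [set z | z < r] by [].
by apply: open_comp; [move=> ? _; exact: norm_continuous|exact: open_lt].
Qed.

Context (A : set (tile R d L)) (D r : R) (c : tile R d L -> 'rV[R]_d).
Context (hA : shape_bounds A D r c).
Let r0 := shape_inner hA.

Lemma center_interior t : A t -> (supp t)^° (c t).
Proof. by move=> At; apply: (shape_center hA) => //; rewrite subrr normr0. Qed.

Lemma center_supp t : A t -> supp t (c t).
Proof. by move=> At; apply: interior_subset; exact: center_interior. Qed.

(** If [t + x = t + y] then [t] is invariant under all multiples of [x - y],
    which are therefore bounded by the diameter of [t]. *)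
Lemma translate_tile_inj t x y : A t ->
  translate_tile t x = translate_tile t y -> x = y.
Proof.
move=> At xy; apply/eqP; rewrite -subr_eq0 -normr_eq0.
apply/eqP; apply: (@bounded_multiples_eq0 _ _ D) => // n.
have tn : supp t (c t + (x - y) *+ n).
  elim: n => [|n IHn]; first by rewrite mulr0n addr0; exact: center_supp.
  have : supp (translate_tile t x) (c t + (x - y) *+ n + x).
    by apply/supp_translate; rewrite addrK.
  by rewrite xy => /supp_translate; rewrite mulrSr !addrA.
rewrite -normrMn; have := shape_diam hA At tn (center_supp At).
by rewrite addrC addKr.
Qed.

(** When [|v| < r] the center of [t] is interior to both [t] and [t + v]. *)
Lemma packing_return T t v : packing T -> T t -> A t ->
  T (translate_tile t v) ->
  `|v| < r -> v = 0.
Proof.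
move=> packT Tt At Ttv vr; apply: (translate_tile_inj At).
rewrite translate_tile0; apply: packT => //; exists (c t); split.
  by apply/interior_translate/(shape_center hA) => //;
    rewrite opprB addrC subrK.
exact: center_interior.
Qed.

(** The centers of distinct tiles are at distance at least [r], so they lie in
    different cubes of a grid of mesh [r]; a bounded region contains finitely
    many cubes. *)
Lemma packing_finite T M : packing T -> T `<=` A ->
  finite_set (tiles_meeting T (sup_ball M)).
Proof.
move=> packT TA; set TM := tiles_meeting _ _; pose B := M + D.
have cB t i : TM t -> `|c t 0 i| <= B.
  move=> [Tt [p [tp pM]]]; apply: le_trans (coord_le_norm _ _) _.
  rewrite -[c t](subrK p) addrC; apply: le_trans (ler_normD _ _) _.
  by rewrite lerD// ?(ltW pM)//; apply: (shape_diam hA (TA _ Tt)) => //;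
    exact/center_supp/TA.
pose k t i := Num.truncn ((c t 0 i + B) / r).
pose K := Num.truncn (2 * B / r).
have kP t i : TM t -> (k t i)%:R <= (c t 0 i + B) / r < (k t i).+1%:R.
  move=> Tt; apply: truncn_itv; rewrite divr_ge0 ?(ltW r0)//.
  by have := cB t i Tt; rewrite ler_norml; lra.
have kK t i : TM t -> (k t i < K.+1)%N.
  move=> Tt; rewrite ltnS le_truncn// ler_pM2r ?invr_gt0//.
  by have := cB t i Tt; rewrite ler_norml; lra.
(* the grid cube containing the center of t *)
pose f t : {ffun 'I_d -> 'I_K.+1} := [ffun i => inord (k t i)].
have -> : TM = \bigcup_(y in f @` TM) (TM `&` [set t | f t = y]).
  apply/seteqP; split=> [t Tt|t [_ _ []//]].
  by exists (f t) => //; exists t.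
apply: bigcup_finite; first exact: finite_finset.
move=> _ [t Tt <-]; apply: (sub_finite_set _ (finite_set1 t)).
move=> t' [Tt' tt']; apply: packT; [exact: Tt'.1|exact: Tt.1|].
exists (c t); split; last by apply: center_interior; exact: TA Tt.1.
apply: (shape_center hA); first exact: TA Tt'.1.
apply: norm_lt_coords => // i; rewrite !mxE.
have kk : k t i = k t' i.
  have /ffunP/(_ i) := tt'; rewrite !ffunE => /(congr1 val) /=.
  by rewrite !inordK ?kK.
have := kP t i Tt; have := kP t' i Tt'; rewrite -kk -natr1.
set K' := (k t i)%:R; rewrite ler_pdivlMr// ltr_pdivrMr// ler_pdivlMr//
  ltr_pdivrMr//.
rewrite ltr_norml; move=> /andP[? ?] /andP[? ?]; apply/andP; split; nra.
Qed.

Lemma packing_locally_finite T : packing T -> T `<=` A -> locally_finite T.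
Proof.
move=> packT TA x; exists (sup_ball (`|x| + 1)); last exact: packing_finite.
apply: open_nbhs_nbhs; split; first exact: open_sup_ball.
by rewrite /sup_ball /= ltrDl.
Qed.

End Packing.

Lemma tiling_packing (R : realType) (d : nat) (L : Type) (T :
  set (tile R d L)) :
  is_tiling T -> packing T.
Proof. by move=> hT t t'; exact: disjoint_interiors. Qed.

(** * The tiling metric and local copies *)

Section Distance.
Context (R : realType) (d : nat) (L : Type).
Implicit Types (T : set (tile R d L)) (t : tile R d L).

Definition near_copy T T' (y : 'rV[R]_d) (M : R) : Prop :=
  forall t, tiles_meeting T (sup_ball M) t -> T' (translate_tile t y).

Let dist_set T T' := [set (Num.sqrt 2)^-1] `|`
       [set eps : R | 0 < eps /\ exists x x' : 'rV[R]_d,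
          [/\ enorm x < eps, enorm x' < eps
            & agree_on (translate T x) (translate T' x')
                (@eball R d eps^-1)]].

Let dist_set_ge0 T T' : lbound (dist_set T T') 0.
Proof. by move=> z [->|[/ltW]//]; rewrite /= invr_ge0 sqrtr_ge0. Qed.

Lemma tiling_dist_ge0 T T' : 0 <= tiling_dist T T'.
Proof.
by apply: lb_le_inf; [exists (Num.sqrt 2)^-1; left|exact: dist_set_ge0].
Qed.

Lemma tiling_dist_le T T' x x' e : 0 < e -> enorm x < e -> enorm x' < e ->
  agree_on (translate T x) (translate T' x') (@eball R d e^-1) ->
  tiling_dist T T' <= e.
Proof.
move=> e0 xe x'e ag; apply: ge_inf; first by exists 0; exact: dist_set_ge0.
by right; split => //; exists x, x'.
Qed.

Lemma tiling_dist_lt T T' e : tiling_dist T T' < e -> e <= (Num.sqrt 2)^-1 ->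
  exists x x' e', [/\ 0 < e', e' < e, enorm x < e', enorm x' < e' &
    agree_on (translate T x) (translate T' x') (@eball R d e'^-1)].
Proof.
move=> dTe e2; have [|e' [->|[e'0 [x [x' [xe x'e ag]]]]] e'e] := inf_lt _ dTe.
- by exists (Num.sqrt 2)^-1; left.
- by rewrite ltNge e2 in e'e.
- by exists x, x', e'.
Qed.

Lemma open_eball e : open (@eball R d e).
Proof.
have -> : @eball R d e = (@enorm R d) @^-1` [set z | z < e] by [].
by apply: open_comp; [move=> ? _; exact: enorm_continuous|exact: open_lt].
Qed.

(** An agreement of [T + x] and [T' + x'] on a ball is a local copy with
    translation [x - x']; conversely a local copy gives an agreement of [T + y]
    and [T'] by [agree_of_sub].  The factor [d] is the cost of exchanging the
    Euclidean and the sup norm. *)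
Lemma cvg_tiling_dist (a b : nat -> set (tile R d L)) :
  (forall n, is_tiling (a n)) -> (forall n, is_tiling (b n)) ->
  (tiling_dist (a n) (b n) @[n --> \oo] --> (0 : R)) <->
  (forall e M, 0 < e -> exists n0, forall n, (n0 <= n)%N ->
     exists2 y, `|y| < e & near_copy (a n) (b n) y M).
Proof.
move=> ha hb; split=> [/cvgrPdist_lt ab e M e0|ab].
  pose M1 := d.+1%:R * (`|M| + 1) : R.
  have M10 : 0 < M1 by rewrite mulr_gt0// ltr_wpDl.
  pose del := Num.min (Num.sqrt 2)^-1 (Num.min (e / 2) M1^-1).
  have del0 : 0 < del by rewrite !lt_min !invr_gt0 sqrtr_gt0 divr_gt0// ltr0n
    M10.
  have [n0 _ abn] := ab _ del0; exists n0 => n n0n.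
  have := abn n n0n; rewrite /= sub0r normrN ger0_norm ?tiling_dist_ge0// => dn.
  have [|x [x' [e' [e'0 e'd xe x'e ag]]]] := tiling_dist_lt dn.
    by rewrite ge_min lexx.
  have [dele delM] : del <= e / 2 /\ del <= M1^-1.
    by rewrite /del; split; rewrite !ge_min lexx ?orbT.
  have nx := le_lt_trans (norm_le_enorm x) xe.
  have nx' := le_lt_trans (norm_le_enorm x') x'e.
  exists (x - x'); first by apply: le_lt_trans (ler_normB _ _) _; lra.
  move=> t [Tt [p [tp pM]]].
  have : tiles_meeting (translate (a n) x) (eball e'^-1) (translate_tile t x).
    split; first by exists t.
    exists (p + x); split; first by apply/supp_translate; rewrite addrK.
    rewrite /eball /=; apply: le_lt_trans (enorm_le_norm _) _.
    apply: (@lt_trans _ _ M1).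
      have M1E : d%:R * `|p + x| <= d%:R * (`|M| + 1).
        rewrite ler_wpM2l//; apply: le_trans (ler_normD _ _) _.
        have : M1^-1 <= 1.
          rewrite invf_le1//; have := normr_ge0 M; rewrite /M1 -natr1.
          have : 0 <= d%:R :> R by []; nra.
        by have := ler_norm M; move: pM; rewrite /sup_ball /=; lra.
      apply: le_lt_trans M1E _; rewrite /M1 ltr_pM2r ?ltr_nat//.
    by rewrite -(invrK M1) ltf_pV2 ?posrE ?invr_gt0//; lra.
  by rewrite ag => -[/translateP]; rewrite translate_tileD.
apply/cvgrPdist_lt => e e0.
pose e1 := e / 2 / d.+1%:R; have e10 : 0 < e1 by rewrite !divr_gt0.
have [n0 abn] := ab e1 ((e / 2)^-1 + e1) e10.
exists n0 => // n /= n0n; rewrite sub0r normrN ger0_norm ?tiling_dist_ge0//.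
have [y ye nc] := abn n n0n.
suff : tiling_dist (a n) (b n) <= e / 2 by lra.
apply: (@tiling_dist_le _ _ y 0).
- by rewrite divr_gt0.
- apply: le_lt_trans (enorm_le_norm _) _;
  rewrite -(mulrVK (_ : d.+1%:R \is a GRing.unit) (e / 2)).
    rewrite -/e1 mulrC; apply: (@le_lt_trans _ _ (`|y| * d.+1%:R)).
      by rewrite ler_wpM2l// ler_nat.
    by rewrite ltr_pM2r.
  by rewrite unitfE pnatr_eq0.
- by rewrite enorm0 divr_gt0.
rewrite translate0; apply/esym/agree_of_sub => //;
  first exact: tiling_translate.
  exact: open_eball.
move=> _ [[t at_ <-] [p [/supp_translate tp pe]]]; apply: nc; split => //.
exists (p - y); split => //; rewrite /sup_ball /=.
apply: le_lt_trans (ler_normB _ _) _; apply: ltrD => //.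
exact: le_lt_trans (norm_le_enorm p) pe.
Qed.

End Distance.

(** * The substitution on Omega *)

Section Substitution.
Context (R : realType) (d : nat) (L : Type) (N : nat)
  (proto : 'I_N -> tile R d L) (lambda : R)
  (w : tile R d L -> set (tile R d L)).
Context (hw : is_substitution proto lambda w).
Implicit Types (P T : set (tile R d L)) (t : tile R d L) (x y : 'rV[R]_d).
Notation tr := (translates_of proto).

Lemma lambda_gt0 : 0 < lambda.
Proof. exact: lt_trans (inflation_gt1 hw). Qed.

Let lambda_neq0 : lambda != 0. Proof. by rewrite gt_eqF// lambda_gt0. Qed.

Lemma translates_translate t x : tr t -> tr (translate_tile t x).
Proof. by move=> [i [y ->]]; exists i, (y + x); rewrite translate_tileD. Qed.

Lemma translate_translates P x : P `<=` tr -> translate P x `<=` tr.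
Proof. by move=> Ptr _ [t /Ptr ? <-]; exact: translates_translate. Qed.

Lemma w_translate t x :
  tr t -> w (translate_tile t x) = translate (w t) (lambda *: x).
Proof.
move=> [i [y ->]]; rewrite translate_tileD !(subst_translate hw) translateD.
by rewrite scalerDr.
Qed.

Lemma w_translates t : tr t -> w t `<=` tr.
Proof.
move=> [i [y ->]]; rewrite (subst_translate hw); apply: translate_translates.
exact: subst_proto hw i.
Qed.

Lemma w_supp t : tr t ->
  \bigcup_(s in w t) supp s = [set lambda *: p | p in supp t].
Proof.
move=> [i [y ->]]; rewrite (subst_translate hw).
apply/seteqP; split=> [p [_ [s ws <-] /supp_translate sp]|_ [_ [q tq <-] <-]].
  have : (\bigcup_(s in w (proto i)) supp s) (p - lambda *: y) by exists s.
  rewrite (subst_supp hw) => -[q tq qp]; exists (q + y); first by exists q.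
  by rewrite scalerDr qp subrK.
have : [set lambda *: p | p in supp (proto i)] (lambda *: q) by exists q.
rewrite -(subst_supp hw) => -[s ws sq].
exists (translate_tile s (lambda *: y)); first by exists s.
by apply/supp_translate; rewrite scalerDr addrK.
Qed.

Lemma subst_translates P : P `<=` tr -> subst w P `<=` tr.
Proof. by move=> Ptr t [s /Ptr/w_translates]; exact. Qed.

Lemma iter_subst_translates n P : P `<=` tr -> iter n (subst w) P `<=` tr.
Proof. by move=> Ptr; elim: n => //= n; exact: subst_translates. Qed.

Lemma subst_translate_set P x : P `<=` tr ->
  subst w (translate P x) = translate (subst w P) (lambda *: x).
Proof.
move=> Ptr; apply/seteqP; split=> [t [_ [s Ps <-]]|_ [t [s Ps ts] <-]].
  rewrite w_translate; last exact: Ptr.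
  by move=> [t' wt' <-]; exists t' => //; exists s.
exists (translate_tile s x); first by exists s.
by rewrite w_translate; [exists t|exact: Ptr].
Qed.

Lemma iter_subst_translate n P x : P `<=` tr ->
  iter n (subst w) (translate P x) =
  translate (iter n (subst w) P) (lambda ^+ n *: x).
Proof.
move=> Ptr; elim: n => [|n /= ->]; first by rewrite /= expr0 scale1r.
by rewrite subst_translate_set ?scalerA -?exprS//; exact: iter_subst_translates.
Qed.

Lemma subst_mono P P' : P `<=` P' -> subst w P `<=` subst w P'.
Proof. by move=> PP' t [s /PP' P's ts]; exists s. Qed.

Lemma iter_subst_mono n P P' : P `<=` P' ->
  iter n (subst w) P `<=` iter n (subst w) P'.
Proof. by move=> PP'; elim: n => //= n; exact: subst_mono. Qed.

(** A tile of [w t] meeting the ball of radius [lambda M] lies in [lambda t], so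
    [t] meets the ball of radius [M]. *)
Lemma near_copy_subst T T' y M : T `<=` tr -> near_copy T T' y M ->
  near_copy (subst w T) (subst w T') (lambda *: y) (lambda * M).
Proof.
move=> Ttr nc s [[t Tt ts] [p [sp pM]]].
have : [set lambda *: p | p in supp t] p by rewrite -w_supp;
  [exists s|exact: Ttr].
move=> [q tq qp].
exists (translate_tile t y).
  apply: nc; split => //; exists q; split => //.
  move: pM; rewrite /sup_ball /= -qp normrZ gtr0_norm ?lambda_gt0//.
  by rewrite ltr_pM2l ?lambda_gt0.
by rewrite w_translate; [exists s|exact: Ttr].
Qed.

Lemma near_copy_iter n T T' y M : T `<=` tr -> near_copy T T' y M ->
  near_copy (iter n (subst w) T) (iter n (subst w) T')
    (lambda ^+ n *: y) (lambda ^+ n * M).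
Proof.
move=> Ttr nc; elim: n => [|n IHn]; first by rewrite expr0 scale1r mul1r.
rewrite exprS -scalerA -mulrA /=; apply: near_copy_subst => //.
exact: iter_subst_translates.
Qed.

Context (w_prim : primitive proto w).
Context (w_fun : set_fun (Omega proto w) (Omega proto w) (subst w)).
Notation Om := (Omega proto w).

Lemma Omega_tiling T : Om T -> is_tiling T. Proof. by case. Qed.
Lemma Omega_translates T : Om T -> T `<=` tr. Proof. by case. Qed.

Lemma Omega_iter n T : Om T -> Om (iter n (subst w) T).
Proof. by move=> hT; elim: n => //= n; exact: w_fun. Qed.

Lemma Omega_translate T x : Om T -> Om (translate T x).
Proof.
move=> [hT Ttr Tpatch]; split.
- exact: tiling_translate.
- exact: translate_translates.
move=> P /(translate_patch (- x)); rewrite translateD subrr translate0.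
move=> /Tpatch[k [j [z Pz]]]; exists k, j, (z + x).
rewrite -translateD -[P]translate0 -(addNr x) -translateD.
exact: image_subset.
Qed.

Context (T0 : set (tile R d L)) (hT0 : Om T0).

(** The image of [T0] contains a translate of some prototile [i]; by primitivity
    the [k]-th image of that tile contains a translate of the prototile [j], and
    it is part of the substitution of the [k]-th image of [T0].
      Starting from the image of
    [T0], and not from [T0], leaves one substitution to spare when [k = 0]. *)
Lemma proto_in_subst j : exists2 S, Om S & subst w S (proto j).
Proof.
have hT1 := w_fun hT0; have [t T1t _] := tiling_tile 0 (Omega_tiling hT1).
have [i [x tE]] := Omega_translates hT1 T1t.
have [k /(_ i j)[y ky]] := w_prim.
have wT : subst w (iter k (subst w) T0) (translate_tile (proto j) (y + lambda
  ^+ k *: x)).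
  rewrite -iterS iterSr.
  apply: (@iter_subst_mono k [set t]); first by move=> _ ->.
  have -> : [set t] = translate [set proto i] x by rewrite /translate
    image_set1 tE.
  rewrite iter_subst_translate; last by move=> _ ->; exists i, 0;
    rewrite translate_tile0.
  by rewrite -translate_tileD; exists (translate_tile (proto j) y).
set z := y + _ in wT.
exists (translate (iter k (subst w) T0) (lambda^-1 *: - z)).
  by apply: Omega_translate; exact: Omega_iter.
rewrite subst_translate_set; last by apply: iter_subst_translates;
  exact: Omega_translates.
rewrite scalerA divff// scale1r.
by exists (translate_tile (proto j) z) => //;
  rewrite translate_tileD subrr translate_tile0.
Qed.

(** Density of the image of the substitution in Omega. *)
Lemma patch_in_subst T P : Om T -> patch_of T P ->
  exists2 S, Om S & P `<=` subst w S.
Proof.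
move=> [_ _ Tpatch] /Tpatch[k [j [x Px]]]; have [S hS Sj] := proto_in_subst j.
have Str := Omega_translates hS.
exists (translate (iter k (subst w) S) (lambda^-1 *: x)).
  by apply: Omega_translate; exact: Omega_iter.
rewrite subst_translate_set; last exact: iter_subst_translates.
rewrite scalerA divff// scale1r; apply: subset_trans Px _; apply: image_subset.
by rewrite -iterS iterSr; apply: iter_subst_mono => _ ->.
Qed.

Lemma proto_interior_nonempty i : (supp (proto i))^° !=set0.
Proof.
have [S hS Si] := proto_in_subst i.
exact: interior_nonempty (Omega_tiling (w_fun hS)) Si.
Qed.

(** Each prototile is compact, and has interior points because it occurs in a
    tiling; there are finitely many of them. *)
Lemma translates_bounds : exists D r c, shape_bounds tr D r c.
Proof.
have bnd i : exists D, forall p, supp (proto i) p -> `|p| <= D.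
  have [M [_ MP]] := compact_bounded (supp_compact (proto_disk hw i)).
  by exists (M + 1) => p; apply: MP; rewrite ltrDl.
have [D DP] := choice bnd.
have inn i : exists rc : R * 'rV[R]_d, 0 < rc.1 /\
    forall p, `|rc.2 - p| < rc.1 -> (supp (proto i))^° p.
  have [c ci] := proto_interior_nonempty i.
  have /nbhs_ballP[e /= e0 eb] :=
    open_nbhs_nbhs (conj (@open_interior _ (supp (proto i))) ci).
  by exists (e, c); split => // p /= pe; apply: eb; rewrite -ball_normE.
have [rc rcP] := choice inn.
pose D' := \big[Order.max/0]_(i < N) D i.
pose r' := \big[Order.min/1]_(i < N) (rc i).1.
have cc t : exists c, tr t -> forall p, `|c - p| < r' -> (supp t)^° p.
  have [[i [x ->]]|ntr] := pselect (tr t); last by exists 0.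
  exists ((rc i).2 + x) => _ p pc; apply/interior_translate/(rcP i).2.
  rewrite opprB addrA; apply: lt_le_trans pc _; exact: bigmin_le.
have [c cP] := choice cc.
exists (D' + D'), r', c; split.
- move=> _ p q [i [x ->]] /supp_translate/DP pD /supp_translate/DP qD.
  have -> : p - q = (p - x) - (q - x) by rewrite opprB addrA subrK.
  have DD : D i <= D' by exact: le_bigmax.
  by apply: le_trans (ler_normB _ _) _; apply: lerD; exact: le_trans DD.
- by apply: lt_bigmin => // i _; exact: (rcP i).1.
- by move=> t p tt; exact: cP.
Qed.

End Substitution.

(** * Preimages under the substitution *)

Lemma filter_finite_bigcap (I T : Type) (F : set_system T) (A : set I)
    (f : I -> set T) : Filter F -> finite_set A ->
  (forall i, A i -> F (f i)) -> F (\bigcap_(i in A) f i).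
Proof.
move=> FF finA Ff.
have [s sA] : exists s : seq {classic I}, A = [set` s] by exact/finite_seqP.
rewrite sA in Ff *; elim: s Ff {sA finA A} => [|i s IHs] Ff.
  by apply: filterS filterT => x _ i; rewrite /= in_nil.
have Fi : F (f i) by apply: Ff; rewrite /= mem_head.
have Fs : F (\bigcap_(i in [set` s]) f i).
  by apply: IHs => j js; apply: Ff; rewrite /= in_cons js orbT.
apply: filterS (filterI Fi Fs) => x [fix_ fsx] j /=.
by rewrite in_cons => /orP[/eqP->//|js]; exact: fsx.
Qed.

Lemma locally_finite_homeo (R : realType) (d : nat) (L : Type)
    (f g : 'rV[R]_d -> 'rV[R]_d) (T : set (tile R d L)) :
  continuous g -> cancel f g -> locally_finite T ->
  locally_finite [set map_tile f t | t in T].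
Proof.
move=> gc fK lfT x; have [U Ux finU] := lfT (g x).
exists (g @^-1` U); first exact: gc.
apply: sub_finite_set (finite_image (map_tile f) finU).
move=> _ [[t Tt <-] [_ [[p tp <-] Up]]]; exists t => //; split => //.
by exists p; split => //; rewrite /preimage /= fK in Up.
Qed.

Section Desubstitution.
Context (R : realType) (d : nat) (L : Type) (N : nat)
  (proto : 'I_N -> tile R d L) (lambda : R)
  (w : tile R d L -> set (tile R d L)).
Context (hw : is_substitution proto lambda w).
Context (w_prim : primitive proto w).
Context (w_fun : set_fun (Omega proto w) (Omega proto w) (subst w)).
Implicit Types (P T : set (tile R d L)) (t : tile R d L) (x y : 'rV[R]_d).
Notation tr := (translates_of proto).
Notation Om := (Omega proto w).

Let lambda0 := lambda_gt0 hw.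
Let lambda_neq0 : lambda != 0. Proof. by rewrite gt_eqF// lambda0. Qed.

Lemma w_finite t : tr t -> finite_set (w t).
Proof.
move=> [i [y ->]]; rewrite (subst_translate hw); apply: finite_image.
by have [T' _ [finw _]] := subst_patch hw i.
Qed.

Section Limit.
Context (D r : R) (c : tile R d L -> 'rV[R]_d).
Context (bounds : shape_bounds tr D r c).

(** A tile of [w s] lies in [lambda s], and [s] is within [D] of [p]. *)
Let w_near s t p : tr s -> supp s p -> w s t ->
  `|c t| <= lambda * (`|p| + D).
Proof.
move=> ss sp st; have tt : tr t by exact: (w_translates hw ss).
have : [set lambda *: q | q in supp s] (c t).
  by rewrite -(w_supp hw ss); exists t => //; exact: center_supp bounds _ tt.
move=> [q sq <-]; rewrite normrZ gtr0_norm// ler_pM2l//.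
rewrite -[q](subrK p) addrC; apply: le_trans (ler_normD _ _) _.
by rewrite lerD2l; exact: (shape_diam bounds ss).
Qed.

Context (T : set (tile R d L)) (hT : Om T).
Let tT := Omega_tiling hT.
Let Ttr := Omega_translates hT.

(** Such an [s] is determined by the prototile of which it is a translate and by
    the place of one chosen tile of [w s], which is a tile of [T] in a bounded
    region. *)
Let supertiles_finite x :
  finite_set [set s | [/\ tr s, supp s x & w s `<=` T]].
Proof.
have u_ex i : exists u, w (proto i) u.
  have [p ip] := supp_nonempty (proto_disk hw i).
  have : [set lambda *: p | p in supp (proto i)] (lambda *: p) by exists p.
  by rewrite -(subst_supp hw) => -[u ? _]; exists u.
have [u uw] := choice u_ex.
have utr i : tr (u i) by exact: (subst_proto hw).
pose TM := tiles_meeting T (sup_ball (lambda * (`|x| + D) + 1)).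
have finTM : finite_set TM by exact: (packing_finite bounds _ (tiling_packing
  tT) Ttr).
pose Y i := (fun y => translate_tile (u i) (lambda *: y)) @^-1` TM.
apply: (@sub_finite_set _ _
  (\bigcup_(i in [set: 'I_N]) [set translate_tile (proto i) y | y in Y i])).
  move=> s [ss sx sT]; have [i [y sE]] := ss; exists i => //.
  exists y => //; have su : w s (translate_tile (u i) (lambda *: y)).
    by rewrite sE (subst_translate hw); exists (u i).
  split; first exact: sT.
  exists (c (translate_tile (u i) (lambda *: y))); split.
    by apply: center_supp bounds _ _; exact: translates_translate.
  by apply: le_lt_trans (w_near ss sx su) _; rewrite ltrDl.
apply: bigcup_finite; first exact: finite_finset.
move=> i _; apply/finite_image/finite_preimage => // y z _ _.
move=> /(translate_tile_inj bounds (utr i)).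
exact: scalerI.
Qed.

(** [S] is the ultralimit of tilings [S_ n] in Omega whose images agree with [T]
    on larger and larger balls. *)
Lemma desubstitution : exists2 S, Om S & subst w S = T.
Proof.
have approx n : exists S, Om S /\
    tiles_meeting (subst w S) (sup_ball n%:R) = tiles_meeting T (sup_ball n%:R).
  have [|S hS PS] := patch_in_subst hw w_prim w_fun hT hT
    (_ : patch_of T (tiles_meeting T (sup_ball n%:R))).
    by split; [exact: (packing_finite bounds _ (tiling_packing tT) Ttr)|move=>
      ? []].
  exists S; split => //; apply: agree_of_sub => //; last exact: open_sup_ball.
  by apply: Omega_tiling; exact: w_fun.
have [S_ S_P] := choice approx.
have hS n : Om (S_ n) := (S_P n).1.
have local n s p : S_ n s -> supp s p -> lambda * (`|p| + D) < n%:R ->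
  w s `<=` T.
  move=> Sns sp pn t wst; have ss := Omega_translates (hS n) Sns.
  have : tiles_meeting (subst w (S_ n)) (sup_ball n%:R) t.
    split; first by exists s.
    exists (c t); split; first exact/(center_supp bounds)/(w_translates hw ss).
    exact: le_lt_trans (w_near ss sp wst) pn.
  by rewrite (S_P n).2 => -[].
have [G [UG ooG]] := ultraFilterLemma eventually_filter.
have FG : ProperFilter G by exact: ultra_proper.
have G_large (M : R) : G [set n | M < n%:R].
  apply: ooG; exists (Num.truncn M).+1 => // n /= Mn.
  by apply: lt_le_trans (truncnS_gt M) _; rewrite ler_nat.
have G_meet (X Y : set nat) : G X -> G Y -> exists n, X n /\ Y n.
  by move=> GX GY; have /filter_ex : G (X `&` Y) by exact: filterI.
pose S : set (tile R d L) := [set s | G [set n | S_ n s]].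
have S_ex P : finite_set P -> P `<=` S -> exists n, P `<=` S_ n.
  move=> finP PS.
  have /filter_ex[n nP] : G (\bigcap_(s in P) [set n | S_ n s]).
    exact: filter_finite_bigcap.
  by exists n => s /nP.
have Str : S `<=` tr.
  by move=> s /filter_ex[n]; exact: Omega_translates.
have ST s : S s -> w s `<=` T.
  move=> Ss; have ss := Str _ Ss.
  have [n [Sns nl]] := G_meet _ _ Ss (G_large (lambda * (`|c s| + D))).
  exact: local Sns (center_supp bounds ss) nl.
have S_cover : \bigcup_(s in S) supp s = setT.
  apply/seteqP; split => // x _; apply: contrapT => nSx.
  (* The tile of S_ n at x belongs, for n large, to the finite set F; hence one
     member of F is a tile of S_ n for almost all n. *)
  pose F := [set s | [/\ tr s, supp s x & w s `<=` T]].
  have GF : G (\bigcap_(s in F) ~` [set n | S_ n s]).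
    apply: filter_finite_bigcap; first exact: supertiles_finite.
    move=> s [_ sx _]; have [Ss|//] := in_ultra_setVsetC [set n | S_ n s] UG.
    by exfalso; apply: nSx; exists s.
  have [n [nF nl]] := G_meet _ _ GF (G_large (lambda * (`|x| + D))).
  have [s Sns sx] := tiling_tile x (Omega_tiling (hS n)).
  apply: (nF s) => //; split => //; first exact: Omega_translates Sns.
  exact: local Sns sx nl.
have S_pairs s s' : S s -> S s' -> exists T', [/\ is_tiling T', T' s & T' s'].
  move=> Ss Ss'; have [|_ [->|->]//|n Sn] := S_ex [set s; s'].
    exact: finite_set2.
  by exists (S_ n); split; [exact: Omega_tiling|apply: Sn; left|apply: Sn;
    right].
have substS : subst w S = T.
  apply/seteqP; split=> [t [s /ST]|t Tt]; first exact.
  have [q tq] := interior_nonempty tT Tt.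
  have : setT (lambda^-1 *: q) by [].
  rewrite -S_cover => -[s Ss sq].
  have : [set lambda *: p | p in supp s] q.
    by exists (lambda^-1 *: q) => //; rewrite scalerA divff// scale1r.
  rewrite -(w_supp hw (Str _ Ss)) => -[t' wt' t'q].
  rewrite (_ : t = t'); first by exists s.
  by apply: (interior_meets tT) => //; [exact: ST wt'|exists q].
exists S => //; split => //; last first.
  move=> P [finP PS]; have [n PSn] := S_ex P finP PS.
  by have [_ _] := hS n; apply; split.
(* It remains to give S a CW-structure, from that of lambda^-1 T. *)
pose f (p : 'rV[R]_d) := lambda^-1 *: p; pose g (p : 'rV[R]_d) := lambda *: p.
have fK : cancel f g by move=> p; rewrite /f /g scalerA divff// scale1r.
have gK : cancel g f by move=> p; rewrite /f /g scalerA mulVf// scale1r.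
have gc : continuous g by exact: scaler_continuous.
have fc : continuous f by exact: scaler_continuous.
apply: (@coarse_tiling _ _ _ [set map_tile f t | t in T]) => //.
- exact: tiling_homeo fc gc fK gK _ tT.
- apply: locally_finite_homeo gc fK _.
  exact: (packing_locally_finite bounds (tiling_packing tT) Ttr).
- apply: (packing_locally_finite bounds) => // s s' Ss Ss'.
  by have [T' [hT' ? ?]] := S_pairs _ _ Ss Ss';
    exact: disjoint_interiors hT' _ _.
- move=> s Ss; exists [set map_tile f t | t in w s].
    split; first exact/finite_image/w_finite/Str.
    by apply: image_subset; exact: ST.
  apply/seteqP; split=> [_ [_ [t wst <-] [p tp <-]]|p sp].
    have : (\bigcup_(t in w s) supp t) p by exists t.
    by rewrite (w_supp hw (Str _ Ss)) => -[q sq <-]; rewrite gK.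
  have : [set lambda *: p | p in supp s] (g p) by exists p.
  rewrite -(w_supp hw (Str _ Ss)) => -[t wst tp].
  by exists (map_tile f t); [exists t|exists (g p); rewrite ?gK].
Qed.

End Limit.
End Desubstitution.

(** * Stable and unstable equivalence *)

Section Equivalences.
Context (R : realType) (d : nat) (L : Type) (N : nat)
  (proto : 'I_N -> tile R d L) (lambda : R)
  (w : tile R d L -> set (tile R d L)).
Context (hw : is_substitution proto lambda w).
Context (w_prim : primitive proto w).
Context (w_fun : set_fun (Omega proto w) (Omega proto w) (subst w)).
Context (w_inj : set_inj (Omega proto w) (subst w)).
Implicit Types (P T : set (tile R d L)) (t : tile R d L) (x y : 'rV[R]_d).
Notation tr := (translates_of proto).
Notation Om := (Omega proto w).
Notation v := (subst_inv proto w).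

Let lambda0 := lambda_gt0 hw.
Let lambda1 := inflation_gt1 hw.
Let lambda_neq0 : lambda != 0. Proof. by rewrite gt_eqF// lambda0. Qed.

Lemma norm_power_scale_eq0 x (e : R) :
  (forall n, `|lambda ^+ n *: x| < e) -> x = 0.
Proof.
move=> xe; apply/eqP; rewrite -normr_eq0; apply: contrapT => /negP xn0.
have x0 : 0 < `|x| by rewrite lt_neqAle eq_sym xn0 /=.
have [n] := power_unbounded (e / `|x|) lambda1.
rewrite ltr_pdivrMr// ltNge => /negP; apply.
have := ltW (xe n); rewrite normrZ ger0_norm ?exprn_ge0 ?(ltW lambda0)//.
Qed.

Section Unique.
Context (D r : R) (c : tile R d L -> 'rV[R]_d).
Context (bounds : shape_bounds tr D r c).
Let r0 := shape_inner bounds.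

(** Both translates of a tile of [T] through 0 are tiles of [T']. *)
Lemma near_copy_unique T T' y z M M' : Om T -> Om T' -> 0 < M -> 0 < M' ->
  near_copy T T' y M -> near_copy T T' z M' -> `|y - z| < r -> y = z.
Proof.
move=> hT hT' M0 M'0 ncy ncz yz.
have [t Tt t0] := tiling_tile 0 (Omega_tiling hT).
have Ty : T' (translate_tile t y).
  by apply: ncy; split => //; exists 0; split => //;
    rewrite /sup_ball /= normr0.
have Tz : T' (translate_tile t z).
  by apply: ncz; split => //; exists 0; split => //;
    rewrite /sup_ball /= normr0.
apply/esym/eqP; rewrite -subr_eq0; apply/eqP.
apply: (packing_return bounds (tiling_packing (Omega_tiling hT')) Ty).
- exact: Omega_translates hT' _ Ty.
- by rewrite translate_tileD addrC subrK.
- by rewrite distrC.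
Qed.

(** Chosen so that [|lambda y - z| < r] whenever [|y|, |z| < e]. *)
Let e := r / (lambda + 1).
Let e0 : 0 < e. Proof. by rewrite divr_gt0// addr_gt0. Qed.
Let close y z : `|y| < e -> `|z| < e -> `|lambda *: y - z| < r.
Proof.
move=> ye ze; apply: le_lt_trans (ler_normB _ _) _; rewrite normrZ gtr0_norm//.
have -> : r = e * (lambda + 1) by rewrite divfK// gt_eqF// addr_gt0.
rewrite mulrDr mulr1 [e * _]mulrC.
by apply: ltrD => //; rewrite ltr_pM2l.
Qed.

Let close1 y z : `|y| < e -> `|z| < e -> `|y - z| < r.
Proof.
move=> ye ze; apply: le_lt_trans (ler_normB _ _) _.
have -> : r = e * (lambda + 1) by rewrite divfK// gt_eqF// addr_gt0.
apply: (@lt_le_trans _ _ (e + e)); first exact: ltrD.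
by rewrite mulrDr mulr1 lerD2r ler_peMr// ltW.
Qed.

(** The translations satisfy [u (k+1) = lambda u k] and stay bounded. *)
Lemma eventually_near_copy_zero (a b : nat -> set (tile R d L)) :
  (forall n, Om (a n)) -> (forall n, Om (b n)) ->
  (forall n, a n.+1 = subst w (a n)) -> (forall n, b n.+1 = subst w (b n)) ->
  (forall e M, 0 < e -> exists n0, forall n, (n0 <= n)%N ->
     exists2 y, `|y| < e & near_copy (a n) (b n) y M) ->
  exists n, near_copy (a n) (b n) 0 1.
Proof.
move=> ha hb aS bS /(_ e 1 e0)[n0 ab].
have near_k k : exists y : 'rV[R]_d,
    `|y| < e /\ near_copy (a (n0 + k)%N) (b (n0 + k)%N) y 1.
  by have [y ? ?] := ab _ (leq_addr k n0); exists y.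
have [u uP] := choice near_k.
have uS k : u k.+1 = lambda *: u k.
  have [yke nck] := uP k; have [ye nc] := uP k.+1.
  apply/esym/(@near_copy_unique (a (n0 + k.+1)%N) (b (n0 + k.+1)%N) _ _
    (lambda * 1) 1) => //.
  - by rewrite mulr1.
  - rewrite addnS aS bS; apply: (near_copy_subst hw) => //;
    exact: Omega_translates.
  - exact: close.
have uE k : u k = lambda ^+ k *: u 0%N.
  by elim: k => [|k IHk]; rewrite ?expr0 ?scale1r// uS IHk scalerA exprS.
exists n0; have [_] := uP 0%N; rewrite addn0.
by rewrite (@norm_power_scale_eq0 (u 0%N) e)// => k; rewrite -uE;
  exact: (uP k).1.
Qed.

(** The translations satisfy [u k = lambda u (k+1)], so a copy at a late stage
    always pushes forward to a copy at stage [n0] with translation [u 0]; its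
    radius can be chosen as large as wanted. *)
Lemma eventually_near_copy_global (a b : nat -> set (tile R d L)) :
  (forall n, Om (a n)) -> (forall n, Om (b n)) ->
  (forall n, a n = subst w (a n.+1)) -> (forall n, b n = subst w (b n.+1)) ->
  (forall e M, 0 < e -> exists n0, forall n, (n0 <= n)%N ->
     exists2 y, `|y| < e & near_copy (a n) (b n) y M) ->
  exists n y, forall M, near_copy (a n) (b n) y M.
Proof.
move=> ha hb aS bS ab; have [n0 abn] := ab e 1 e0.
have aE n k : a n = iter k (subst w) (a (n + k)%N).
  by elim: k => [|k IHk]; rewrite ?addn0// addnS iterSr -aS.
have bE n k : b n = iter k (subst w) (b (n + k)%N).
  by elim: k => [|k IHk]; rewrite ?addn0// addnS iterSr -bS.
have near_k k : exists y : 'rV[R]_d,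
    `|y| < e /\ near_copy (a (n0 + k)%N) (b (n0 + k)%N) y 1.
  by have [y ? ?] := abn _ (leq_addr k n0); exists y.
have [u uP] := choice near_k.
have uS k : u k = lambda *: u k.+1.
  have [yke nck] := uP k; have [ye nc] := uP k.+1.
  apply/esym/(@near_copy_unique (a (n0 + k)%N) (b (n0 + k)%N) _ _ (lambda * 1)
    1) => //.
  - by rewrite mulr1.
  - by rewrite aS bS -addnS; apply: (near_copy_subst hw) => //;
    exact: Omega_translates.
  - exact: close.
have uE k : u 0%N = lambda ^+ k *: u k.
  by elim: k => [|k IHk]; rewrite ?expr0 ?scale1r// IHk (uS k) scalerA exprSr.
exists n0, (u 0%N) => M.
have [n1 abM] := ab e (`|M| + 1) e0.
have [z ze ncz] := abM _ (leq_addl n0 n1).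
have M1 : 0 < `|M| + 1 by rewrite ltr_wpDl.
have zy : z = u n1.
  have [yn ncy] := uP n1.
  by apply: near_copy_unique M1 ltr01 ncz ncy _ => //; exact: close1.
rewrite (uE n1) -zy (aE n0 n1) (bE n0 n1).
have nc := near_copy_iter hw (n:=n1) (Omega_translates (ha _)) ncz.
move=> t [at_ [p [tp pM]]]; apply: nc; split => //; exists p; split => //.
apply: lt_le_trans pM _; apply: (@le_trans _ _ (`|M| + 1)).
  by have := ler_norm M; lra.
by rewrite ler_peMl ?(ltW M1)// exprn_ege1// ltW.
Qed.

End Unique.

Lemma Omega_bounds T : Om T -> exists D r c, shape_bounds tr D r c.
Proof. by move=> hT; exact: (translates_bounds hw w_prim w_fun hT). Qed.

Lemma subst_surj : set_surj Om Om (subst w).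
Proof.
move=> T hT; have [D [r [c bounds]]] := Omega_bounds hT.
have [S hS ST] := desubstitution hw w_prim w_fun bounds hT.
by exists S.
Qed.

Lemma subst_invK T : Om T -> subst w (v T) = T.
Proof. by move=> hT; apply: (surjpK _ subst_surj); rewrite inE. Qed.

Lemma subst_inv_Omega T : Om T -> Om (v T).
Proof. by move=> hT; apply: (surjpinv_image_sub subst_surj); exists T. Qed.

(** Both sides are in Omega and have the same substitution. *)
Lemma subst_inv_translate T x : Om T ->
  v (translate T x) = translate (v T) (lambda^-1 *: x).
Proof.
move=> hT; have hv := subst_inv_Omega hT.
apply: w_inj; rewrite ?inE.
- exact/subst_inv_Omega/Omega_translate.
- exact: Omega_translate.
rewrite subst_invK; last exact: Omega_translate.
rewrite (subst_translate_set hw); last exact: (Omega_translates hv).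
by rewrite subst_invK// scalerA divff// scale1r.
Qed.

Lemma iter_inv_Omega n T : Om T -> Om (iter n v T).
Proof. by move=> hT; elim: n => //= n; exact: subst_inv_Omega. Qed.

Lemma stable_equivP T T' : Om T -> Om T' ->
  stable_equiv w T T' <->
     exists n : nat,
       tiles_meeting (iter n (subst w) T) [set (0 : 'rV[R]_d)] =
       tiles_meeting (iter n (subst w) T') [set (0 : 'rV[R]_d)].
Proof.
move=> hT hT'; have [D [r [c bounds]]] := Omega_bounds hT.
have hTn n : Om (iter n (subst w) T) by exact: Omega_iter.
have hT'n n : Om (iter n (subst w) T') by exact: Omega_iter.
rewrite /stable_equiv cvg_tiling_dist; first split; last 2 first.
- by move=> n; exact: Omega_tiling.
- by move=> n; exact: Omega_tiling.
- move=> /(eventually_near_copy_zero bounds hTn hT'n) [//|//|n nc].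
  exists n; have ag : tiles_meeting (iter n (subst w) T') (sup_ball 1) =
      tiles_meeting (iter n (subst w) T) (sup_ball 1).
    apply: agree_of_sub; try exact: Omega_tiling.
      exact: open_sup_ball.
    by move=> t /nc; rewrite translate_tile0.
  have ball0 U t : tiles_meeting U [set 0] t -> tiles_meeting U (sup_ball 1) t.
    move=> [Ut [p [tp /= p0]]]; split => //; exists p; split => //.
    by rewrite /sup_ball /= p0 normr0.
  apply/seteqP; split=> t tU; split; try by case: tU.
    by have := ball0 _ _ tU; rewrite -ag => -[].
  by have := ball0 _ _ tU; rewrite ag => -[].
move=> [n ag e M e0].
have lf : locally_finite (iter n (subst w) T).
  apply: (packing_locally_finite bounds); last exact: Omega_translates.
  exact/tiling_packing/Omega_tiling.
have [V V0 VT] := star_nbhs 0 lf (fun t => tiling_closed (Omega_tiling (hTn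
  n))).
have [del /= del0 delV] : exists2 del : R, 0 < del & sup_ball del `<=` V.
  have /nbhs_ballP[del del0 delV] := V0; exists del => // p pd; apply: delV.
  by rewrite -ball_normE /ball_ /= sub0r normrN.
have nc : near_copy (iter n (subst w) T) (iter n (subst w) T') 0 del.
  move=> t [Tt [p [tp pd]]]; rewrite translate_tile0.
  suff : tiles_meeting (iter n (subst w) T) [set 0] t by rewrite ag => -[].
  split => //; exists 0; split => //; apply: VT => //.
  by exists p; split => //; exact: delV.
have [k Mk] := power_unbounded (M / del) lambda1.
exists (n + k)%N => m nkm; exists 0; first by rewrite normr0.
have -> : m = (m - n + n)%N by rewrite subnK// (leq_trans (leq_addr _ _) nkm).
rewrite !iterD -(scaler0 _ (lambda ^+ (m - n))).
have {}nc := near_copy_iter hw (n:=m - n) (Omega_translates (hTn n)) nc.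
move=> t [Tt [p [tp pM]]]; apply: nc; split => //; exists p; split => //.
apply: lt_le_trans pM _; rewrite -ler_pdivrMr//; apply: le_trans (ltW Mk) _.
by rewrite ler_weXn2l ?ltW// leq_subRL// (leq_trans (leq_addr _ _) nkm).
Qed.

Lemma unstable_equivP T T' : Om T -> Om T' ->
  unstable_equiv proto w T T' <-> exists x : 'rV[R]_d, T' = translate T x.
Proof.
move=> hT hT'; have [D [r [c bounds]]] := Omega_bounds hT.
have hTn n : Om (iter n v T) by exact: iter_inv_Omega.
have hT'n n : Om (iter n v T') by exact: iter_inv_Omega.
have iterK n S : Om S -> iter n (subst w) (iter n v S) = S.
  move=> hS; elim: n => // n IHn; rewrite iterSr [iter n.+1 v S]iterS.
  by rewrite subst_invK//; exact: iter_inv_Omega.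
rewrite /unstable_equiv cvg_tiling_dist; first split; last 2 first.
- by move=> n; exact: Omega_tiling.
- by move=> n; exact: Omega_tiling.
- move=> /(eventually_near_copy_global bounds hTn hT'n)[n|n|n [y nc]].
  + by rewrite /= subst_invK.
  + by rewrite /= subst_invK.
  exists (lambda ^+ n *: y); rewrite -[LHS](iterK n)// -[in RHS](iterK n T)//.
  rewrite -(iter_subst_translate hw); last exact: Omega_translates.
  congr iter; apply/seteqP.
  have := @agree_of_sub _ _ _ (translate (iter n v T) y) (iter n v T') setT
    (tiling_translate _ (Omega_tiling (hTn n))) (Omega_tiling (hT'n n)) openT.
  have meetT U t : is_tiling U -> U t -> tiles_meeting U setT t.
    move=> hU Ut; split => //; rewrite setIT.
    exact/supp_nonempty/(tiling_homeomorphic hU).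
  have sub : translate (iter n v T) y `<=` iter n v T'.
    move=> _ [t Tt <-]; have [p tp] :=
      supp_nonempty (tiling_homeomorphic (Omega_tiling (hTn n)) Tt).
    apply: (nc (`|p| + 1)); split => //; exists p; split => //.
    by rewrite /sup_ball /= ltrDl.
  move=> ag; split => // t T't.
  have := meetT _ _ (Omega_tiling (hT'n n)) T't.
  by rewrite ag => [[]//|s [/sub]].
move=> [x ->] e M e0.
have vE n : iter n v (translate T x) = translate (iter n v T) (lambda ^- n *:
  x).
  elim: n => [|n IHn]; first by rewrite /= expr0 invr1 scale1r.
  by rewrite !iterS IHn subst_inv_translate// scalerA exprS invfM.
have [n0 xn0] := power_unbounded (`|x| / e) lambda1.
exists n0 => n n0n; exists (lambda ^- n *: x).
  have ln : 0 < lambda ^+ n by rewrite exprn_gt0.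
  rewrite normrZ normfV gtr0_norm// mulrC ltr_pdivrMr// mulrC -ltr_pdivrMr//.
  by apply: lt_le_trans xn0 _; rewrite ler_weXn2l// ltW.
by move=> t [Tt _]; rewrite vE; exists t.
Qed.

End Equivalences.

Theorem proposition1p1 (R : realType) (d : nat) (L : Type) (N : nat)
    (proto : 'I_N -> tile R d L) (lambda : R)
    (w : tile R d L -> set (tile R d L))
    (w_subst : is_substitution proto lambda w)
    (w_flc : finite_local_complexity proto w)
    (w_primitive : primitive proto w)
    (w_fun : set_fun (Omega proto w) (Omega proto w) (subst w))
    (w_inj : set_inj (Omega proto w) (subst w))
    (T T' : set (tile R d L)) (hT : Omega proto w T) (hT' : Omega proto w T') :
  (stable_equiv w T T' <->
     exists n : nat,
       tiles_meeting (iter n (subst w) T) [set (0 : 'rV[R]_d)] =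
       tiles_meeting (iter n (subst w) T') [set (0 : 'rV[R]_d)])
  /\
  (unstable_equiv proto w T T' <->
     exists x : 'rV[R]_d, T' = translate T x).
Proof.
split; first exact: stable_equivP w_subst w_primitive w_fun _ _ hT hT'.
exact: unstable_equivP w_subst w_primitive w_fun w_inj _ _ hT hT'.
Qed.
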